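(* Fix $d>0$, a finite set $\Omega$, an integer $k\geq 3$, a finite nonempty set $\Psi$ of functions $\Omega^k\to(0,\infty)$ and a probability distribution $\rho$ on $\Psi$, and let $\mathbf G_n=\mathbf G_n(d,\Omega,k,\Psi,\rho)$ be the Poisson random factor graph. Assume the static replica symmetry condition $$\lim_{n\to\infty}\frac1{n^2}\sum_{i,j=1}^n\mathbb E\left\|\mu_{\mathbf G_n,x_i,x_j}-\mu_{\mathbf G_n,x_i}\otimes\mu_{\mathbf G_n,x_j}\right\|_{TV}=0 .$$ Then there is a sequence $(\varepsilon_n)_n$ with $\varepsilon_n\to0$ such that, with probability tending to $1$ as $n\to\infty$, the family of messages $(\mu_{\mathbf G_n,x\to a},\mu_{\mathbf G_n,a\to x})_{x\in V(\mathbf G_n),a\in\partial x}$ is an $\varepsilon_n$-Belief Propagation fixed point on $\mathbf G_n$.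
   Context: Factor graphs: Fix a finite set $\Omega$ of spins. A factor graph $G$ consists of a finite set $V(G)$ of variable nodes, a finite set $F(G)$ of constraint nodes, for each $a\in F(G)$ an ordered tuple $\partial a=(y_1,\ldots,y_{d(a)})$ of variable nodes, and a weight function $\psi_a:\Omega^{d(a)}\to(0,\infty)$. For $x\in V(G)$ let $\partial x$ be the set of $a\in F(G)$ with $x$ appearing in $\partial a$; we also write $\partial a$ for the set of variable nodes appearing in the tuple. For $\tau\in\Omega^{\partial a}$ (an assignment of spins to the variables of $\partial a$) write $\psi_a(\tau)=\psi_a(\tau(y_1),\ldots,\tau(y_{d(a)}))$. The Gibbs measure is $\mu_G(\sigma)=Z_G^{-1}\prod_{a\in F(G)}\psi_a(\sigma(\partial a))$ for $\sigma\in\Omega^{V(G)}$, where $Z_G=\sum_{\sigma\in\Omega^{V(G)}}\prod_{a}\psi_a(\sigma(\partial a))$ is the partition function. $\mu_{G,x}$ denotes the marginal distribution of $\sigma(x)$ under $\mu_G$ and $\mu_{G,x,y}$ the joint distribution of $(\sigma(x),\sigma(y))$. For $x\in\partial a$ the message $\mu_{G,x\to a}\in\mathcal P(\Omega)$ is the marginal of $x$ in the Gibbs measure of the factor graph $G-a$ obtained by deleting the constraint node $a$, and $\mu_{G,a\to x}$ is the marginal of $x$ in the Gibbs measure of the factor graph obtained from $G$ by deleting all constraint nodes $b\in\partial x\setminus\{a\}$. $\|\cdot\|_{TV}$ is total variation distance. $\varepsilon$-BP fixed point: For a factor graph $G$ with $n$ variable nodes, the messages form an $\varepsilon$-Belief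 Propagation fixed point if $$\sum_{x\in V(G)}\sum_{a\in\partial x}\sum_{\sigma\in\Omega}\left|\mu_{G,x\to a}(\sigma)-\frac{\prod_{b\in\partial x\setminus a}\mu_{G,b\to x}(\sigma)}{\sum_{\tau\in\Omega}\prod_{b\in\partial x\setminus a}\mu_{G,b\to x}(\tau)}\right|+\left|\mu_{G,a\to x}(\sigma)-\frac{\sum_{\tau\in\Omega^{\partial a}}\mathbf 1\{\tau(x)=\sigma\}\psi_a(\tau)\prod_{y\in\partial a\setminus x}\mu_{G,y\to a}(\tau(y))}{\sum_{\tau\in\Omega^{\partial a}}\psi_a(\tau)\prod_{y\in\partial a\setminus x}\mu_{G,y\to a}(\tau(y))}\right|<\varepsilon n.$$ Poisson random factor graph $\mathbf G_n(d,\Omega,k,\Psi,\rho)$: variable nodes $x_1,\ldots,x_n$; constraint nodes $a_1,\ldots,a_m$ where $m$ is Poisson with mean $dn/k$; independently for each $i$, $\psi_{a_i}\in\Psi$ is drawn from $\rho$ and $\partial a_i$ is a uniformly random $k$-tuple in $\{x_1,\ldots,x_n\}^k$. The parameters $d,\Omega,k,\Psi,\rho$ are fixed as $n\to\infty$. Expectations $\mathbb E$ are over the random factor graph. *)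

(* Defs.v *)
From Stdlib Require Import Reals.
From mathcomp Require Import all_boot.
Set Implicit Arguments. Unset Strict Implicit. Unset Printing Implicit Defensive.

Local Open Scope R_scope.

Definition rsum (T : Type) (s : seq T) (F : T -> R) : R :=
  foldr (fun x acc => F x + acc) 0 s.
Definition rprod (T : Type) (s : seq T) (F : T -> R) : R :=
  foldr (fun x acc => F x * acc) 1 s.

Definition tv (T : finType) (p q : T -> R) : R :=
  / 2 * rsum (enum T) (fun t => Rabs (p t - q t)).

Section FactorGraph.
Variables (Omega : finType) (k n m : nat).

(* A factor graph with variable nodes 'I_n (x_1..x_n) and constraint nodes
   'I_m (a_1..a_m), all of arity k: constraint a has weight function
   fw a : Omega^k -> R and ordered tuple of variables ft a. *)
Record fgraph := FG {
  fw : 'I_m -> {ffun 'I_k -> Omega} -> R ;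
  ft : 'I_m -> {ffun 'I_k -> 'I_n} }.

Definition vars (t : {ffun 'I_k -> 'I_n}) : {set 'I_n} := [set t i | i : 'I_k].

Lemma mem_vars (t : {ffun 'I_k -> 'I_n}) (i : 'I_k) : t i \in vars t.
Proof. by apply/imsetP; exists i. Qed.

Definition dx (G : fgraph) (x : 'I_n) : {set 'I_m} :=
  [set a | x \in vars (ft G a)].

Definition cval (t : {ffun 'I_k -> 'I_n}) (s : {ffun 'I_n -> Omega})
  : {ffun 'I_k -> Omega} := [ffun i => s (t i)].

(* Gibbs weight of the factor graph keeping only the constraint nodes in A
   (A = setT is G itself; deleting constraint nodes = shrinking A). *)
Definition weight (G : fgraph) (A : {set 'I_m}) (s : {ffun 'I_n -> Omega}) : R :=
  rprod (enum A) (fun a => fw G a (cval (ft G a) s)).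

Definition Zpart (G : fgraph) (A : {set 'I_m}) : R :=
  rsum (enum {ffun 'I_n -> Omega}) (weight G A).

Definition marg (G : fgraph) (A : {set 'I_m}) (x : 'I_n) (w : Omega) : R :=
  rsum [seq s : {ffun 'I_n -> Omega} <- enum {ffun 'I_n -> Omega} | s x == w] (weight G A) / Zpart G A.

Definition marg2 (G : fgraph) (A : {set 'I_m}) (x y : 'I_n) (p : Omega * Omega) : R :=
  rsum [seq s : {ffun 'I_n -> Omega} <- enum {ffun 'I_n -> Omega} | (s x == p.1) && (s y == p.2)]
       (weight G A) / Zpart G A.

Definition msg_va (G : fgraph) (x : 'I_n) (a : 'I_m) (w : Omega) : R :=
  marg G (setT :\ a) x w.
Definition msg_av (G : fgraph) (x : 'I_n) (a : 'I_m) (w : Omega) : R :=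
  marg G [set b | (b == a) || (x \notin vars (ft G b))] x w.

Definition vsub (t : {ffun 'I_k -> 'I_n}) : finType := {y : 'I_n | y \in vars t}.

Definition psi_tau (G : fgraph) (a : 'I_m) (tau : {ffun vsub (ft G a) -> Omega}) : R :=
  fw G a [ffun i => tau (exist _ (ft G a i) (mem_vars (ft G a) i))].

Definition fac_term (G : fgraph) (x : 'I_n) (a : 'I_m)
  (tau : {ffun vsub (ft G a) -> Omega}) : R :=
  psi_tau tau * rprod [seq y : vsub (ft G a) <- enum (vsub (ft G a)) | val y != x]
                      (fun y => msg_va G (val y) a (tau y)).

Definition fac_update (G : fgraph) (x : 'I_n) (a : 'I_m) (w : Omega) : R :=
  rsum [seq tau : {ffun vsub (ft G a) -> Omega} <- enum {ffun vsub (ft G a) -> Omega}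
         | [exists y, (val y == x) && (tau y == w)]] (@fac_term G x a)
  / rsum (enum {ffun vsub (ft G a) -> Omega}) (@fac_term G x a).

Definition var_update (G : fgraph) (x : 'I_n) (a : 'I_m) (w : Omega) : R :=
  rprod (enum (dx G x :\ a)) (fun b => msg_av G x b w)
  / rsum (enum Omega) (fun t => rprod (enum (dx G x :\ a)) (fun b => msg_av G x b t)).

Definition bp_err (G : fgraph) : R :=
  rsum (enum 'I_n) (fun x => rsum (enum (dx G x)) (fun a => rsum (enum Omega) (fun w =>
    Rabs (msg_va G x a w - var_update G x a w)
    + Rabs (msg_av G x a w - fac_update G x a w)))).

Definition is_eps_BP (eps : R) (G : fgraph) : Prop := bp_err G < eps * INR n.

Definition bp_ind (eps : R) (G : fgraph) : R :=
  if Rlt_dec (bp_err G) (eps * INR n) then 1 else 0.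

Definition rs_stat (G : fgraph) : R :=
  / (INR n ^ 2) * rsum (enum 'I_n) (fun i => rsum (enum 'I_n) (fun j =>
    tv (marg2 G setT i j) (fun p => marg G setT i p.1 * marg G setT j p.2))).

End FactorGraph.

(* ---- The Poisson random factor graph G_n(d, Omega, k, Psi, rho) ----
   Psi is given as a finite nonempty family psi indexed by a finType P,
   rho a probability distribution on P. *)

Definition poisson (lam : R) (m : nat) : R := exp (- lam) * lam ^ m / INR (Factorial.fact m).

Section Random.
Variables (Omega : finType) (k n : nat) (P : finType)
  (psi : P -> {ffun 'I_k -> Omega} -> R) (rho : P -> R).

Definition sample (m : nat) := {ffun 'I_m -> P * {ffun 'I_k -> 'I_n}}.

Definition graph_of (m : nat) (om : sample m) : fgraph Omega k n m :=
  FG (fun a => psi (om a).1) (fun a => (om a).2).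

Definition sample_prob (m : nat) (om : sample m) : R :=
  rprod (enum 'I_m) (fun a => rho (om a).1 / INR n ^ k).

(* m-th term of E[X(G_n)] = sum_m Po(dn/k)(m) * E[X(G_n) | m] *)
Definition Eterm (d : R) (X : forall m, fgraph Omega k n m -> R) (m : nat) : R :=
  poisson (d * INR n / INR k) m *
  rsum (enum (sample m)) (fun om => sample_prob om * X m (graph_of om)).

End Random.

(* Main.v *)
Require Import Defs.
From Stdlib Require Import Reals IndefiniteDescription.
From mathcomp Require Import all_boot all_order all_algebra.
From mathcomp Require Import ring lra.
From mathcomp Require Import Rstruct.

(* Let a be a constraint of G. Given G - a, its tuple is uniform, so the
   variables y at a other than a given x are independent of G - a. For a fixed
   observable F of G - a, expanding E[(c F - sum_y +-(1{s(y) = w} -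
   P(s(y) = w)))^2] >= 0 bounds the average over y of |cov(1{s(y) = w}, F)| by
   the replica symmetry functional of G - a. Hence, on average, the spins at
   the k - 1 other variables of a behave as independent of one another and of
   F. With F an indicator {s(x) = w} divided by weights of constraints at x, this
   describes the Gibbs measure of graphs in which some constraints at x are
   deleted, and both Belief Propagation equations follow: the factor equation
   directly, the variable equation by inserting the constraints at x one by one.
   Variables of degree > D and tuples with a repeated variable contribute
   O(1/D) and O(1/n). The Poisson identity (m+1) Po(m+1) = lambda Po(m) passes
   from G - a back to a Poisson graph, so that E[bp_err] = o(n), and Markov's
   inequality concludes. *)

Set Implicit Arguments. Unset Strict Implicit. Unset Printing Implicit Defensive.
Import Order.TTheory GRing.Theory Num.Theory.
Local Open Scope ring_scope.

(** * Covariance with a family of observables *)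

(** The messages at a variable x live in several graphs, each lacking other constraints at x, and
    replica symmetry is not assumed for any of these. One reference measure, the Gibbs measure of G
    - a, avoids comparing measures: deleting constraints at x is division by a bounded weight, so
    only the observable F changes. The price is a factor K per constraint at x, whence the degree
    cutoff D. The remaining constants may grow arbitrarily with D, since parameters are chosen in
    the order D, eta, n, where eta is c / n for the free constant c of the quadratic expansion. Once
    G - a and the variable x at position i of a are fixed, neither the reference measure nor F
    depends on the variables at the positions j != i; hence all subsets of the constraints at x can
    be treated in the same way, at a total cost of 2 ^ D. *)

Section FiniteProbability.
Variables (R : realFieldType) (S : finType) (mu : S -> R).
Hypotheses (mu_ge0 : forall s, 0 <= mu s) (mu_sum : \sum_s mu s = 1).

Definition expect (f : S -> R) : R := \sum_s mu s * f s.
Definition cov (f g : S -> R) : R :=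
  expect (fun s => f s * g s) - expect f * expect g.

Lemma eq_expect f g : f =1 g -> expect f = expect g.
Proof. by move=> fg; apply: eq_bigr => s _; rewrite fg. Qed.

Lemma expectD f g : expect (fun s => f s + g s) = expect f + expect g.
Proof. by rewrite -big_split; apply: eq_bigr => s _; rewrite mulrDr. Qed.

Lemma expectZ c f : expect (fun s => c * f s) = c * expect f.
Proof. by rewrite /expect mulr_sumr; apply: eq_bigr => s _; rewrite mulrCA. Qed.

Lemma expect_cst c : expect (fun=> c) = c.
Proof. by rewrite /expect -mulr_suml mu_sum mul1r. Qed.

Lemma expect_sum (I : finType) (f : I -> S -> R) :
  expect (fun s => \sum_i f i s) = \sum_i expect (f i).
Proof.
rewrite /expect exchange_big; apply: eq_bigr => s _.
by rewrite mulr_sumr.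
Qed.

Lemma expect_ge0 f : (forall s, 0 <= f s) -> 0 <= expect f.
Proof. by move=> f0; apply: sumr_ge0 => s _; apply: mulr_ge0. Qed.

Lemma le_expect f g : (forall s, f s <= g s) -> expect f <= expect g.
Proof. by move=> fg; apply: ler_sum => s _; apply: ler_wpM2l. Qed.

Lemma cov_center f g :
  cov f g = expect (fun s => (f s - expect f) * g s).
Proof.
transitivity (expect (fun s => f s * g s + (- expect f) * g s)).
  by rewrite expectD expectZ mulNr.
by apply: eq_expect => s; rewrite mulrBl mulNr.
Qed.

Lemma cov_center2 f g :
  cov f g = expect (fun s => (f s - expect f) * (g s - expect g)).
Proof.
have h0 : expect (fun s => f s - expect f) = 0.
  by rewrite expectD expect_cst subrr.
rewrite cov_center -[LHS]subr0 -(mulr0 (expect g)) -[X in _ * X]h0 -mulNr.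
by rewrite -expectZ -expectD; apply: eq_expect => s; ring.
Qed.

(* Expand E[(c F - S)^2] >= 0, where S = sum_i sign(cov (X i) F) (X i - E X i). *)
Lemma sum_cov_le (I : finType) (X : I -> S -> R) (F : S -> R) (M c : R) :
  0 < c -> (forall s, `|F s| <= M) ->
  \sum_i `|cov (X i) F| <=
    (c * M ^+ 2 + (\sum_i \sum_j `|cov (X i) (X j)|) / c) / 2.
Proof.
move=> c0 FM.
pose e i := Num.sg (cov (X i) F).
pose Sm s := \sum_i e i * (X i s - expect (X i)).
have e1 i : `|e i| <= 1 by rewrite normr_sg lern1 leq_b1.
have eF : expect (fun s => Sm s * F s) = \sum_i `|cov (X i) F|.
  transitivity (\sum_i e i * cov (X i) F).
    rewrite -(eq_bigr _ (fun i _ => congr1 (fun z => e i * z)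
      (esym (cov_center (X i) F)))).
    under [RHS]eq_bigr do rewrite -expectZ.
    rewrite -expect_sum; apply: eq_expect => s.
    by rewrite mulr_suml; apply: eq_bigr => i _; rewrite mulrA.
  by apply: eq_bigr => i _; rewrite -normrEsg.
have eS : expect (fun s => Sm s * Sm s) <= \sum_i \sum_j `|cov (X i) (X j)|.
  have -> : expect (fun s => Sm s * Sm s) =
      \sum_i \sum_j e i * e j * cov (X i) (X j).
    under [RHS]eq_bigr do under eq_bigr do rewrite cov_center2 -expectZ.
    under [RHS]eq_bigr do rewrite -expect_sum.
    rewrite -expect_sum; apply: eq_expect => s.
    rewrite /Sm mulr_suml; apply: eq_bigr => i _.
    by rewrite mulr_sumr; apply: eq_bigr => j _; ring.
  apply: ler_sum => i _; apply: ler_sum => j _.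
  apply: le_trans (ler_norm _) _; rewrite !normrM.
  by rewrite ler_piMl // mulr_ile1.
have eFF : expect (fun s => F s * F s) <= M ^+ 2.
  rewrite -[leRHS]expect_cst; apply: le_expect => s.
  by have := FM s; rewrite ler_norml => /andP[]; nra.
have : 0 <= expect (fun s => (c * F s - Sm s) * (c * F s - Sm s)).
  by apply: expect_ge0 => s; rewrite -expr2 sqr_ge0.
have -> : expect (fun s => (c * F s - Sm s) * (c * F s - Sm s)) =
   c ^+ 2 * expect (fun s => F s * F s) + ((-2 * c) * expect (fun s => Sm s * F s)
   + expect (fun s => Sm s * Sm s)).
  by rewrite -!expectZ -!expectD; apply: eq_expect => s; ring.
rewrite eF; set V := \sum_i \sum_j _ in eS *; set T := \sum_i _ => h.
have cV : c * (V / c) = V by rewrite mulrC divfK ?gt_eqF.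
rewrite ler_pdivlMr // -(ler_pM2l c0).
have : c ^+ 2 * expect (fun s => F s * F s) <= c ^+ 2 * M ^+ 2.
  by rewrite ler_wpM2l // sqr_ge0.
nra.
Qed.

End FiniteProbability.

(** * Resampling one coordinate of a product measure *)

Section Resampling.
Variables (R : comPzRingType) (I T : finType).

Definition upd (f : {ffun I -> T}) (a : I) (v : T) : {ffun I -> T} :=
  [ffun b => if b == a then v else f b].

Lemma updE f a v b : upd f a v b = if b == a then v else f b.
Proof. by rewrite ffunE. Qed.

Lemma upd_same f a v : upd f a v a = v. Proof. by rewrite ffunE eqxx. Qed.

Lemma upd_upd f a v w : upd (upd f a v) a w = upd f a w.
Proof. by apply/ffunP => b; rewrite !ffunE; case: eqP. Qed.

Lemma upd_id f a : upd f a (f a) = f.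
Proof. by apply/ffunP => b; rewrite ffunE; case: eqP => // ->. Qed.

(* The swap (f, v) |-> (upd f a v, f a) is an involution preserving the
   weight (\prod_b u (f b)) * u v. *)
Lemma resample (u : T -> R) (a : I) (h : {ffun I -> T} -> R) :
  \sum_(f : {ffun I -> T}) (\prod_b u (f b)) * (\sum_v u v * h (upd f a v)) =
  (\sum_v u v) * \sum_(f : {ffun I -> T}) (\prod_b u (f b)) * h f.
Proof.
pose w (p : {ffun I -> T} * T) := (\prod_b u (p.1 b)) * u p.2.
pose sw (p : {ffun I -> T} * T) := (upd p.1 a p.2, p.1 a).
have swK : involutive sw by case=> f v; rewrite /sw /= upd_upd upd_id upd_same.
have wsw p : w (sw p) = w p.
  rewrite /w /= (bigD1 a) //= [in RHS](bigD1 a) //= upd_same.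
  rewrite mulrAC [RHS]mulrAC [u p.2 * _]mulrC; congr (_ * _).
  by apply: eq_bigr => b /negPf ba; rewrite updE ba.
transitivity (\sum_p w p * h (sw p).1).
  rewrite -(pair_big predT predT (fun f v => w (f, v) * h (sw (f, v)).1)) /=.
  by apply: eq_bigr => f _; rewrite mulr_sumr; apply: eq_bigr => v _; rewrite mulrA.
rewrite (reindex_inj (inv_inj swK)).
under eq_bigr do rewrite wsw swK.
rewrite -(pair_big predT predT (fun f v => w (f, v) * h f)) /=.
rewrite mulr_sumr; apply: eq_bigr => f _; rewrite /w /= mulrA [_ * h f]mulrC.
by rewrite mulr_suml mulr_sumr; apply: eq_bigr => v _; ring.
Qed.

End Resampling.

(** Inserting a value at coordinate a is a bijection, so under a product measure the other
    coordinates again form a product measure. This identifies the law of G - a with that of a random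
    graph on m constraints. *)
Lemma sum_ffun_lift (R : comPzRingType) (T : finType) (m : nat)
    (u : T -> R) (a : 'I_m.+1) (h : {ffun 'I_m -> T} -> R) :
  \sum_(f : {ffun 'I_m.+1 -> T})
     (\prod_b u (f b)) * h [ffun b => f (lift a b)] =
  (\sum_v u v) * \sum_(f : {ffun 'I_m -> T}) (\prod_b u (f b)) * h f.
Proof.
pose ins (p : {ffun 'I_m -> T} * T) : {ffun 'I_m.+1 -> T} :=
  [ffun b => oapp p.1 p.2 (unlift a b)].
pose del (f : {ffun 'I_m.+1 -> T}) := ([ffun b => f (lift a b)] : {ffun 'I_m -> T}, f a).
have insK : cancel ins del.
  case=> f v; rewrite /del /ins ffunE unlift_none; congr (_, _).
  by apply/ffunP => b; rewrite !ffunE liftK.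
have delK : cancel del ins.
  move=> f; apply/ffunP => b; rewrite ffunE.
  by case: unliftP => [j|] -> //=; rewrite ffunE.
rewrite (reindex ins) /=; last by exists del => p _; [apply: insK | apply: delK].
transitivity (\sum_(p : {ffun 'I_m -> T} * T) (u p.2 * \prod_b u (p.1 b)) * h p.1).
  apply: eq_bigr => -[f v] _ /=; congr (_ * h _).
    rewrite (bigD1_ord a) //= ffunE unlift_none; congr (_ * _).
    by apply: eq_bigr => b _; rewrite ffunE liftK.
  by apply/ffunP => b; rewrite !ffunE liftK.
rewrite -(pair_big predT predT
  (fun (f : {ffun 'I_m -> T}) v => (u v * \prod_b u (f b)) * h f)) /=.
rewrite mulr_sumr; apply: eq_bigr => f _; rewrite mulr_suml.
by apply: eq_bigr => v _; rewrite mulrA.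
Qed.

Lemma resample_unif (R : comPzRingType) (I T : finType) (a : I)
    (h : {ffun I -> T} -> R) :
  \sum_(f : {ffun I -> T}) \sum_v h (upd f a v) =
  #|T|%:R * \sum_(f : {ffun I -> T}) h f.
Proof.
transitivity (\sum_(f : {ffun I -> T})
    (\prod_(b : I) 1) * (\sum_v 1 * h (upd f a v))).
  apply: eq_bigr => f _; rewrite big1_eq mul1r.
  by apply: eq_bigr => v _; rewrite mul1r.
rewrite (resample (fun=> 1)) sumr_const; congr (_ * _).
by apply: eq_bigr => f _; rewrite big1_eq mul1r.
Qed.

Lemma sum_coord_eq (R : comPzRingType) (I T : finType) (i : I) (x : T) :
  #|T|%:R * \sum_(f : {ffun I -> T}) (f i == x)%:R = #|T|%:R ^+ #|I| :> R.
Proof.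
rewrite -(resample_unif i) -natrX -card_ffun.
under eq_bigr do under eq_bigr do rewrite upd_same mulrb.
under eq_bigr do rewrite -big_mkcond big_pred1_eq.
by rewrite sumr_const.
Qed.

(* Resampling the coordinate j turns the j-th factor into a covariance with
   an observable that does not depend on t j. *)
Lemma sum_prod_cov_le (R : realFieldType) (S I V : finType) (mu : S -> R)
    (X : I -> V -> S -> R) (M B : R) :
  (forall s, 0 <= mu s) -> \sum_s mu s = 1 ->
  (forall j y s, 0 <= X j y s <= 1) ->
  (forall j (F : S -> R), (forall s, `|F s| <= M) ->
     \sum_y `|cov mu (X j y) F| <= B) ->
  forall (J : seq I) (i : I) (x : V) (F : S -> R),
  uniq J -> i \notin J -> (forall s, `|F s| <= M) ->
  #|V|%:R * \sum_(t : {ffun I -> V}) (t i == x)%:R *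
    `|expect mu (fun s => (\prod_(j <- J) X j (t j) s) * F s)
      - (\prod_(j <- J) expect mu (X j (t j))) * expect mu F|
  <= (size J)%:R * (B * \sum_(t : {ffun I -> V}) (t i == x)%:R).
Proof.
move=> mu0 mu1 X01 hB J i x F + + FM.
have B0 : 0 <= B.
  by apply: le_trans (hB i F FM); apply: sumr_ge0.
have E01 j y : `|expect mu (X j y)| <= 1.
  rewrite ger0_norm; last first.
    by apply: expect_ge0 => // s; case/andP: (X01 j y s).
  rewrite -[leRHS](expect_cst mu1); apply: le_expect => // s.
  by case/andP: (X01 j y s).
elim: J => [_ _|j J IH /= /andP[jJ uJ]].
  rewrite big1 ?mulr0 ?mul0r // => t _.
  rewrite big_nil mul1r (@eq_expect _ _ mu _ F) ?subrr ?normr0 ?mulr0 // => s.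
  by rewrite big_nil mul1r.
rewrite inE negb_or => /andP[ij iJ].
pose FJ (t : {ffun I -> V}) s := (\prod_(j0 <- J) X j0 (t j0) s) * F s.
have FJM t s : `|FJ t s| <= M.
  rewrite /FJ normrM; apply: le_trans (FM s); rewrite ler_piMl //.
  rewrite normr_prod; apply: prodr_ile1 => j0 _.
  by rewrite normr_ge0 ger0_norm; case/andP: (X01 j0 (t j0) s).
pose D t := `|expect mu (FJ t) - (\prod_(j0 <- J) expect mu (X j0 (t j0))) * expect mu F|.
have step (t : {ffun I -> V}) :
  `|expect mu (fun s => (\prod_(j0 <- j :: J) X j0 (t j0) s) * F s)
      - (\prod_(j0 <- j :: J) expect mu (X j0 (t j0))) * expect mu F|
  <= `|cov mu (X j (t j)) (FJ t)| + D t.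
  (* Peel off the factor j: its covariance with the rest is new, and the old error gets multiplied
     by a mean of absolute value at most 1. *)
  have -> : expect mu (fun s => (\prod_(j0 <- j :: J) X j0 (t j0) s) * F s)
      - (\prod_(j0 <- j :: J) expect mu (X j0 (t j0))) * expect mu F
    = cov mu (X j (t j)) (FJ t) + expect mu (X j (t j)) *
     (expect mu (FJ t) - (\prod_(j0 <- J) expect mu (X j0 (t j0))) * expect mu F).
    rewrite /cov big_cons.
    rewrite (@eq_expect _ _ mu _ (fun s => X j (t j) s * FJ t s)); last first.
      by move=> s; rewrite big_cons /FJ mulrA.
    by ring.
  apply: le_trans (ler_normD _ _) _; rewrite lerD2l normrM.
  by rewrite ler_piMl.
apply: le_trans (_ : #|V|%:R *
  (\sum_(t : {ffun I -> V}) (t i == x)%:R * `|cov mu (X j (t j)) (FJ t)|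
   + \sum_(t : {ffun I -> V}) (t i == x)%:R * D t) <= _).
  rewrite ler_wpM2l // -big_split /=; apply: ler_sum => t _.
  by rewrite -mulrDr ler_wpM2l.
rewrite mulrDr -natr1 mulrDl mul1r addrC; apply: lerD; first exact: IH.
rewrite -(resample_unif j) mulr_sumr; apply: ler_sum => t _.
rewrite mulrC; under eq_bigr => y _.
  rewrite updE (negPf ij) upd_same.
  rewrite (_ : cov _ _ _ = cov mu (X j y) (FJ t)); first over.
  rewrite /cov; congr (_ - _ * _); apply: eq_expect => s; rewrite /FJ.
    congr (_ * (_ * _)); apply: eq_big_seq => j0 j0J; rewrite updE.
    by case: eqP j0J jJ => // -> ->.
  congr (_ * _); apply: eq_big_seq => j0 j0J; rewrite updE.
  by case: eqP j0J jJ => // -> ->.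
rewrite -mulr_sumr; apply: ler_wpM2l => //; exact: hB.
Qed.

(** Union bound over the ordered pairs of positions: resampling one of the two shows that a given
    pair collides with probability 1 / #|T|. *)
Lemma sum_not_inj (R : realFieldType) (I T : finType) :
  #|T|%:R * \sum_(f : {ffun I -> T}) (~~ injectiveb f)%:R
    <= (#|I| ^ 2)%:R * #|T|%:R ^+ #|I| :> R.
Proof.
have le1 (f : {ffun I -> T}) : (~~ injectiveb f)%:R <=
    \sum_(i : I) \sum_(j : I | j != i) (f i == f j)%:R :> R.
  case: injectiveP => [_|/injectiveP /injectivePn [i [j ij fij]]] /=.
    by do 2!apply: sumr_ge0 => ? _.
  rewrite (bigD1 i) //= (bigD1 j) 1?eq_sym //= fij eqxx -addrA lerDl.
  by apply: addr_ge0; do ?[apply: sumr_ge0 => ? _] => //.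
apply: le_trans (_ : #|T|%:R * \sum_(f : {ffun I -> T})
   \sum_(i : I) \sum_(j : I | j != i) (f i == f j)%:R <= _).
  by rewrite ler_wpM2l // ler_sum.
rewrite exchange_big /= mulr_sumr natrX expr2 -mulrA.
rewrite [leRHS](_ : _ = \sum_(i : I) \sum_(j : I) #|T|%:R ^+ #|I|); last first.
  by rewrite !sumr_const -mulrnA -[RHS]mulr_natl natrM -mulrA.
apply: ler_sum => i _; rewrite exchange_big /= mulr_sumr big_mkcond.
apply: ler_sum => j _; case: ifP => // ji; last by rewrite exprn_ge0.
rewrite -(resample_unif j).
rewrite -natrX -card_ffun -sum1_card natr_sum ler_sum // => f _.
under eq_bigr => y _ do
  rewrite upd_same updE [i == j]eq_sym (negPf ji) eq_sym mulrb.
by rewrite -big_mkcond big_pred1_eq.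
Qed.

(** * Normalisation and approximate multiplicativity *)

(** The factor 2 counts two equal costs: changing the numerator, and changing the total mass, which
    moves by at most the same l1 distance. *)
Lemma sum_normalize_le (R : realFieldType) (T : finType) (p q : T -> R) :
  (forall t, 0 <= p t) -> (forall t, 0 <= q t) -> 0 < \sum_t p t ->
  \sum_t `|p t / (\sum_u p u) - q t / (\sum_u q u)|
    <= 2 * (\sum_t `|p t - q t|) / \sum_t p t.
Proof.
move=> p0 q0; set P := \sum_u p u; set Q := \sum_u q u => P0.
have Q0 : 0 <= Q by apply: sumr_ge0.
have hPQ : `|P - Q| <= \sum_t `|p t - q t|.
  by rewrite -sumrB ler_norm_sum.
apply: le_trans (_ : \sum_t (`|p t - q t| / P + q t * `|P^-1 - Q^-1|) <= _).
  apply: ler_sum => t _.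
  have -> : p t / P - q t / Q = (p t - q t) / P + q t * (P^-1 - Q^-1) by ring.
  apply: le_trans (ler_normD _ _) _.
  by rewrite !normrM (ger0_norm (q0 t)) normfV (gtr0_norm P0).
rewrite big_split /= -!mulr_suml -/Q; set D := \sum_t _ in hPQ *.
have -> : 2 * D / P = D / P + D / P by ring.
rewrite lerD2l.
(* Division by 0 yields 0; the second term is multiplied by Q and disappears. *)
have [->|Qn0] := eqVneq Q 0.
  by rewrite mul0r divr_ge0 ?sumr_ge0 // ltW.
have Qp : 0 < Q by rewrite lt_def Qn0.
have -> : P^-1 - Q^-1 = (Q - P) / (P * Q) by field; rewrite Qn0 gt_eqF.
rewrite normrM normfV (gtr0_norm (mulr_gt0 P0 Qp)) distrC.
rewrite [leLHS](_ : _ = `|P - Q| / P); last by field; rewrite Qn0 gt_eqF.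
by rewrite ler_pM2r ?invr_gt0.
Qed.

Lemma sum_dist_normalize_le2 (R : realFieldType) (T : finType) (p q : T -> R) :
  (forall t, 0 <= p t) -> (forall t, 0 <= q t) ->
  \sum_t p t <= 1 -> \sum_t q t <= 1 -> \sum_t `|p t - q t| <= 2.
Proof.
move=> p0 q0 p1 q1; apply: le_trans (_ : \sum_t (p t + q t) <= _).
  apply: ler_sum => t _; apply: le_trans (ler_normB _ _) _.
  by rewrite !ger0_norm.
by rewrite big_split /=; lra.
Qed.

(** Removing b from B costs e b, and so does replacing [theta b] by [p [set b]], which is the case B
    = set0; thus theta cancels from the conclusion. The error already made for B minus b is
    multiplied by [p [set b]], at most K, whence K ^+ #|B|. *)
Lemma almost_multiplicative (R : realFieldType) (T : finType)
    (p : {set T} -> R) (theta e : T -> R) (U : {set T}) (K M : R) :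
  1 <= K -> p set0 = 1 ->
  (forall B : {set T}, B \subset U -> 0 <= p B <= M) ->
  (forall b, b \in U -> 0 <= p [set b] <= K) ->
  (forall b (B : {set T}), b \in U -> B \subset U -> b \notin B ->
     `|p (b |: B) - theta b * p B| <= e b) ->
  forall B : {set T}, B \subset U ->
  `|p B - \prod_(b in B) p [set b]| <= K ^+ #|B| * (1 + M) * \sum_(b in B) e b.
Proof.
move=> K1 p0 pM pK step B.
have e0 b : b \in U -> 0 <= e b.
  move=> bU; apply: le_trans (step b set0 bU (sub0set _) _) => //.
  by rewrite inE.
have M0 : 0 <= M by have /andP[] := pM set0 (sub0set _); apply: le_trans.
move: {2}#|B| (erefl #|B|) => N; elim: N B => [|N IH] B cB BU.
  by move/eqP: cB; rewrite cards_eq0 => /eqP ->; rewrite !big_set0 p0 subrr normr0 mulr0.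
have /card_gt0P [b bB] : (0 < #|B|)%N by rewrite cB.
have bU := subsetP BU _ bB.
have BU' : B :\ b \subset U by apply: subset_trans BU; apply: subsetDl.
have cB' : #|B :\ b| = N by move: cB; rewrite (cardsD1 b) bB => -[].
have /IH := cB' => /(_ BU') IHB.
have hb : b \notin B :\ b by rewrite !inE eqxx.
have h1 := step b (B :\ b) bU BU' hb.
have := step b set0 bU (sub0set _) (negbT (in_set0 _)).
rewrite setD1K // in h1; rewrite setU0 p0 mulr1 => h2.
rewrite !(big_setD1 b bB) /= cB.
rewrite cB' in IHB.
have /andP[q0 qM] := pM _ BU'; have /andP[b0 bK] := pK _ bU.
set q := p (B :\ b) in h1 IHB q0 qM *; set P := \prod_(_ in _) _ in IHB *.
set E := \sum_(_ in _) _ in IHB *.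
have -> : p B - p [set b] * P = (p B - theta b * q) -
    ((p [set b] - theta b) * q) + p [set b] * (q - P) by ring.
apply: le_trans (ler_normD _ _) _.
have hKN : 1 <= K ^+ N by rewrite exprn_ege1.
have hE : 0 <= E by apply: sumr_ge0 => c cB2; apply: e0; apply: (subsetP BU').
have eb := e0 b bU.
rewrite exprS [leRHS](_ : _ = (K * K ^+ N) * (1 + M) * e b +
   K * (K ^+ N * (1 + M) * E)); last by ring.
apply: lerD; last by rewrite normrM (ger0_norm b0); apply: ler_pM.
apply: le_trans (ler_normB _ _) _.
apply: le_trans (_ : e b + e b * M <= _).
  by apply: lerD => //; rewrite normrM (ger0_norm q0); apply: ler_pM.
rewrite -{1}[e b]mulr1 -mulrDr mulrC ler_wpM2r //.
by rewrite ler_peMl ?addr_ge0 // mulr_ege1.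
Qed.

(** * Gibbs measures with constraints deleted *)

Local Notation R := Rdefinitions.R.

Lemma rsum_big (T : Type) (s : seq T) (F : T -> R) :
  rsum s F = \sum_(x <- s) F x.
Proof. by elim: s => [|x s IH]; rewrite ?big_nil ?big_cons //= IH. Qed.

Lemma rprod_big (T : Type) (s : seq T) (F : T -> R) :
  rprod s F = \prod_(x <- s) F x.
Proof. by elim: s => [|x s IH]; rewrite ?big_nil ?big_cons //= IH. Qed.

Lemma rsum_enum (T : finType) (P : {pred T}) (F : T -> R) :
  rsum (enum P) F = \sum_(x in P) F x.
Proof. by rewrite rsum_big big_enum. Qed.

Lemma rprod_enum (T : finType) (P : {pred T}) (F : T -> R) :
  rprod (enum P) F = \prod_(x in P) F x.
Proof. by rewrite rprod_big big_enum. Qed.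

Lemma rsum_filter_enum (T : finType) (P : pred T) (F : T -> R) :
  rsum [seq x <- enum T | P x] F = \sum_(x | P x) F x.
Proof. by rewrite rsum_big big_filter big_enum_cond. Qed.

Section Gibbs.
Variables (Omega : finType) (k n m : nat) (G : Defs.fgraph Omega k n m).
Local Notation config := {ffun 'I_n -> Omega}.
Implicit Types (A B : {set 'I_m}) (s : config) (x : 'I_n) (w : Omega).

Lemma weightE A s : weight G A s = \prod_(a in A) fw G a (cval (ft G a) s).
Proof. exact: rprod_enum. Qed.

Lemma ZpartE A : Zpart G A = \sum_(s : config) weight G A s.
Proof. exact: rsum_enum. Qed.

Lemma margE A x w :
  marg G A x w = (\sum_(s : config | s x == w) weight G A s) / Zpart G A.
Proof. by rewrite /marg RdivE rsum_filter_enum. Qed.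

Lemma marg2E A x y p :
  marg2 G A x y p =
  (\sum_(s : config | (s x == p.1) && (s y == p.2)) weight G A s) / Zpart G A.
Proof. by rewrite /marg2 RdivE rsum_filter_enum. Qed.

Lemma sum_weight_marg A x : \sum_w \sum_(s : config | s x == w) weight G A s = Zpart G A.
Proof. by rewrite ZpartE (partition_big (fun s : config => s x) predT). Qed.

Lemma weightU A B s : [disjoint A & B] ->
  weight G (A :|: B) s = weight G A s * weight G B s.
Proof.
move=> AB; rewrite !weightE (eq_bigl [in [predU A & B]]) ?bigU // => a.
by rewrite !inE.
Qed.

Variable K : R.
Hypotheses (K1 : 1 <= K) (hK : forall a tau, K^-1 <= fw G a tau <= K).
Hypothesis Omega_gt0 : (0 < #|Omega|)%N.

Let K_gt0 : 0 < K. Proof. by apply: lt_le_trans K1. Qed.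

Lemma weight_bounds A s D : (#|A| <= D)%N ->
  (K ^+ D)^-1 <= weight G A s <= K ^+ D.
Proof.
move=> AD; rewrite weightE.
have V0 : 0 <= K^-1 by rewrite invr_ge0 ltW.
apply/andP; split.
  apply: le_trans (_ : \prod_(a in A) K^-1 <= _).
    rewrite prodr_const exprVn lef_pV2 ?posrE ?exprn_gt0 //.
    exact: ler_weXn2l.
  by apply: ler_prod => a _; rewrite V0; case/andP: (hK a (cval (ft G a) s)).
apply: le_trans (_ : \prod_(a in A) K <= _).
  apply: ler_prod => a _; case/andP: (hK a (cval (ft G a) s)) => h1 h2.
  by rewrite (le_trans V0 h1).
by rewrite prodr_const; apply: ler_weXn2l.
Qed.

Lemma weight_gt0 A s : 0 < weight G A s.
Proof.
have /andP[h _] := weight_bounds s (leqnn #|A|).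
by apply: lt_le_trans h; rewrite invr_gt0 exprn_gt0.
Qed.

Lemma Zpart_gt0 A : 0 < Zpart G A.
Proof.
have /card_gt0P [w0 _] := Omega_gt0.
rewrite ZpartE (bigD1 [ffun=> w0]) //= ltr_pwDl ?weight_gt0 //.
by apply: sumr_ge0 => s _; apply/ltW/weight_gt0.
Qed.

Lemma sum_weight_ge0 A (P : pred config) : 0 <= \sum_(s : config | P s) weight G A s.
Proof. by apply: sumr_ge0 => s _; apply/ltW/weight_gt0. Qed.

Lemma marg_ge0 A x w : 0 <= marg G A x w.
Proof. by rewrite margE divr_ge0 ?sum_weight_ge0 ?ltW ?Zpart_gt0. Qed.

Lemma marg_sum1 A x : \sum_w marg G A x w = 1.
Proof.
under eq_bigr do rewrite margE.
by rewrite -mulr_suml sum_weight_marg divff // gt_eqF ?Zpart_gt0.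
Qed.

(** Without its constraints x is isolated, so its spin is uniform. *)
Lemma sum_weight_isolated x w :
  #|Omega|%:R * \sum_(s : config | s x == w) weight G (~: dx G x) s =
  Zpart G (~: dx G x).
Proof.
have upd_weight s v : weight G (~: dx G x) (upd s x v) = weight G (~: dx G x) s.
  rewrite !weightE; apply: eq_bigr => a; rewrite !inE => xa; congr fw.
  apply/ffunP => i; rewrite !ffunE; case: eqP => // xi.
  by rewrite -xi mem_vars in xa.
rewrite big_mkcond -(resample_unif x) ZpartE; apply: eq_bigr => s _.
under eq_bigr do rewrite upd_same upd_weight.
by rewrite -big_mkcond big_pred1_eq.
Qed.

(* The conditional expectation of \prod_(b in B) psi_b given sigma(x) = w, in
   the graph from which the neighbours of x have been removed. *)
Definition cavity x w B : R :=
  (#|Omega|%:R * (\sum_(s : config | s x == w) weight G (~: dx G x :|: B) s)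
  / Zpart G (~: dx G x))%R.

Lemma cavity0 x w : cavity x w set0 = 1.
Proof.
by rewrite /cavity setU0 sum_weight_isolated divff // gt_eqF ?Zpart_gt0.
Qed.

Lemma cavity_bounds x w B D : B \subset dx G x -> (#|B| <= D)%N ->
  (K ^+ D)^-1 <= cavity x w B <= K ^+ D.
Proof.
move=> Bx BD; have Z0 := Zpart_gt0 (~: dx G x).
have dis : [disjoint ~: dx G x & B].
  by rewrite disjoints_subset setCS.
have O0 : 0 <= #|Omega|%:R :> R by [].
rewrite /cavity ler_pdivlMr // ler_pdivrMr // -(sum_weight_isolated x w).
rewrite ![_ ^+ D * (_ * _)]mulrCA ![_^-1 * (_ * _)]mulrCA; apply/andP; split.
  rewrite ler_wpM2l // mulr_sumr ler_sum // => s _.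
  rewrite weightU // mulrC ler_wpM2l ?(ltW (weight_gt0 _ _)) //.
  by case/andP: (weight_bounds s BD).
rewrite ler_wpM2l // mulr_sumr ler_sum // => s _.
rewrite weightU // mulrC ler_wpM2r ?(ltW (weight_gt0 _ _)) //.
by case/andP: (weight_bounds s BD).
Qed.

Lemma marg_cavity x w B :
  marg G (~: dx G x :|: B) x w = cavity x w B / \sum_t cavity x t B.
Proof.
have Z0 := Zpart_gt0 (~: dx G x); have Z1 := Zpart_gt0 (~: dx G x :|: B).
rewrite margE /cavity -mulr_suml -mulr_sumr sum_weight_marg.
have O0 : #|Omega|%:R != 0 :> R by rewrite pnatr_eq0 -lt0n.
by field; rewrite O0 !gt_eqF.
Qed.

Lemma msg_va_cavity x a w : a \in dx G x ->
  msg_va G x a w = cavity x w (dx G x :\ a) / \sum_t cavity x t (dx G x :\ a).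
Proof.
move=> ax; rewrite -marg_cavity /msg_va; congr marg; apply/setP => b.
by rewrite !inE; move: ax; rewrite inE; case: eqP => [->->|_ _] //=; rewrite orNb.
Qed.

Lemma msg_av_cavity x a w :
  msg_av G x a w = cavity x w [set a] / \sum_t cavity x t [set a].
Proof.
rewrite -marg_cavity /msg_av; congr marg; apply/setP => b.
by rewrite !inE orbC.
Qed.

(** Each message into x is a cavity value up to a constant independent of the spin, and such
    constants cancel on normalising. The variable equation thus reduces to multiplicativity of
    [cavity x w] over sets of constraints. *)
Lemma var_update_cavity x a w :
  var_update G x a w = (\prod_(b in dx G x :\ a) cavity x w [set b])
    / \sum_t \prod_(b in dx G x :\ a) cavity x t [set b].
Proof.
rewrite /var_update RdivE rprod_enum rsum_enum.
under [X in _ / X = _]eq_bigr do rewrite rprod_enum.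
pose c b := (\sum_t cavity x t [set b])^-1.
have prodE t : \prod_(b in dx G x :\ a) msg_av G x b t =
    (\prod_(b in dx G x :\ a) cavity x t [set b]) * \prod_(b in dx G x :\ a) c b.
  by rewrite -big_split; apply: eq_bigr => b _; rewrite msg_av_cavity.
under [X in _ / X = _]eq_bigr do rewrite prodE.
rewrite prodE -mulr_suml -mulf_div divff ?mulr1 //.
apply/prodf_neq0 => b bx; rewrite invr_eq0 gt_eqF //.
have /card_gt0P [w0 _] := Omega_gt0.
have bx' : [set b] \subset dx G x by rewrite sub1set; case/setD1P: bx.
have cv t : 0 < cavity x t [set b].
  have /andP[h _] := cavity_bounds t bx' (leqnn _).
  by apply: lt_le_trans h; rewrite invr_gt0 exprn_gt0.
rewrite (bigD1 w0) //= ltr_pwDl // sumr_ge0 // => t _; exact: ltW.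
Qed.
End Gibbs.

(** * Belief Propagation error of a fixed graph *)

Section LocalError.
Variables (Omega : finType) (k n m : nat) (G : Defs.fgraph Omega k n m).
Local Notation config := {ffun 'I_n -> Omega}.
Local Notation loc := {ffun 'I_k -> Omega}.
Implicit Types (A B : {set 'I_m}) (s : config) (x : 'I_n) (w : Omega).

(** Indexed by positions, so that it can be averaged over the tuple; for an injective tuple it is
    the product over the other variables of a. *)
Definition prod_marg (a : 'I_m) (i : 'I_k) (tau : loc) : R :=
  (\prod_(j | j != i) marg G (setT :\ a) (ft G a j) (tau j))%R.

(* Measured with the unnormalised weights of the constraints in A, how far the
   spins at the positions j != i of a are from being independent of one another
   and of the spin at position i; the product of marginals comes from G - a. *)
Definition gap (a : 'I_m) (i : 'I_k) A (tau : loc) : R :=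
  (`|\sum_(s : config | cval (ft G a) s == tau) weight G A s
     - prod_marg a i tau *
       \sum_(s : config | s (ft G a i) == tau i) weight G A s|)%R.

Lemma gap_ge0 a i A tau : 0 <= gap a i A tau.
Proof. exact: normr_ge0. Qed.

(* The numerator of the factor update from a to its i-th variable. *)
Definition theta (a : 'I_m) (i : 'I_k) (w : Omega) : R :=
  (\sum_(tau : loc | tau i == w) fw G a tau * prod_marg a i tau)%R.

(* B ranges over the constraints at the variable that stay in the graph next to
   a; all of these occur when they are inserted one at a time. *)
Definition discrepancy (a : 'I_m) (i : 'I_k) : R :=
  (\sum_(B in powerset (dx G (ft G a i) :\ a)) \sum_(tau : loc)
     gap a i (~: dx G (ft G a i) :|: B) tau / Zpart G (setT :\ a))%R.

Variable K : R.
Hypotheses (K1 : 1 <= K) (hK : forall a tau, K^-1 <= fw G a tau <= K).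
Hypothesis Omega_gt0 : (0 < #|Omega|)%N.

Let K_gt0 : 0 < K. Proof. by apply: lt_le_trans K1. Qed.

Lemma fw_ge0 a tau : 0 <= fw G a tau.
Proof. by case/andP: (hK a tau) => h _; apply: le_trans h; rewrite invr_ge0 ltW. Qed.

Lemma prod_marg_ge0 a i tau : 0 <= prod_marg a i tau.
Proof. by apply: prodr_ge0 => j _; apply: (marg_ge0 K1 hK). Qed.

Lemma theta_ge0 a i w : 0 <= theta a i w.
Proof. by apply: sumr_ge0 => t _; rewrite mulr_ge0 ?fw_ge0 ?prod_marg_ge0. Qed.

Lemma discrepancy_ge0 a i : 0 <= discrepancy a i.
Proof.
apply: sumr_ge0 => B _; apply: sumr_ge0 => tau _.
by rewrite divr_ge0 ?gap_ge0 // ltW // (Zpart_gt0 K1 hK).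
Qed.

(** Sort configurations by the spins tau they show at a: on each class the new constraint is the
    constant [fw G a tau], at most K, and the class itself is off by [gap]. *)
Lemma insert_constraint a i A w : a \notin A ->
  `|(\sum_(s : config | s (ft G a i) == w) weight G (a |: A) s)
     - theta a i w * \sum_(s : config | s (ft G a i) == w) weight G A s|
  <= K * \sum_(tau : loc) gap a i A tau.
Proof.
move=> aA.
have wU s : weight G (a |: A) s = fw G a (cval (ft G a) s) * weight G A s.
  by rewrite !weightE big_setU1.
under eq_bigr do rewrite wU.
rewrite (partition_big (cval (ft G a)) (fun tau : loc => tau i == w)) /=; last first.
  by move=> s; rewrite ffunE.
have -> : theta a i w * (\sum_(s : config | s (ft G a i) == w) weight G A s) =
  \sum_(tau : loc | tau i == w) fw G a tau * (prod_marg a i tau *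
    \sum_(s : config | s (ft G a i) == tau i) weight G A s).
  rewrite /theta mulr_suml; apply: eq_bigr => tau /eqP <-.
  by rewrite mulrA.
rewrite -sumrB mulr_sumr [leRHS](bigID (fun tau : loc => tau i == w)) /=.
apply: le_trans (ler_norm_sum _ _ _) _.
rewrite -[leLHS]addr0; apply: lerD; last first.
  by apply: sumr_ge0 => tau _; rewrite mulr_ge0 ?gap_ge0 // ltW.
apply: ler_sum => tau /eqP tw.
rewrite (_ : \sum_(s | _ && _) _ = fw G a tau *
    \sum_(s : config | cval (ft G a) s == tau) weight G A s); last first.
  rewrite mulr_sumr; apply: eq_big => [s|s /andP[_ /eqP ->] //].
  by case: (cval (ft G a) s =P tau) => [e|]; rewrite ?andbF // andbT -tw -e ffunE eqxx.
rewrite -mulrBr normrM ger0_norm ?fw_ge0 // ler_wpM2r //.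
by case/andP: (hK a tau).
Qed.

(* A variable may fill several positions of a; the sum over i avoids choosing
   one. *)
Definition slack (D : nat) (x : 'I_n) (a : 'I_m) : R :=
  (\sum_(i | ft G a i == x) K ^+ D.+1 * #|Omega|%:R * discrepancy a i)%R.

Lemma slack_ge0 D x a : 0 <= slack D x a.
Proof.
by apply: sumr_ge0 => i _; rewrite !mulr_ge0 ?exprn_ge0 ?discrepancy_ge0 // ltW.
Qed.

(** [cavity] is normalised by the graph without the constraints at x, [discrepancy] by G - a. The
    two partition functions differ by at most K ^+ D in the direction used; with the K of
    [insert_constraint] this gives K ^+ D.+1. *)
Lemma cavity_insert D x w a i B : (#|dx G x| <= D)%N -> ft G a i = x ->
  B \subset dx G x -> a \notin B ->
  `|cavity G x w (a |: B) - theta a i w * cavity G x w B| <= slack D x a.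
Proof.
move=> xD ax Bx aB.
have adx : a \in dx G x by rewrite inE -ax mem_vars.
apply: le_trans (_ : K ^+ D.+1 * #|Omega|%:R * discrepancy a i <= _); last first.
  rewrite /slack (bigD1 i) /= ?ax // lerDl; apply: sumr_ge0 => j _.
  by rewrite !mulr_ge0 ?exprn_ge0 ?discrepancy_ge0 // ltW.
have Z0 := Zpart_gt0 K1 hK Omega_gt0 (~: dx G x).
have Z1 := Zpart_gt0 K1 hK Omega_gt0 (setT :\ a).
have ZZ : Zpart G (setT :\ a) <= K ^+ D * Zpart G (~: dx G x).
  have -> : setT :\ a = ~: dx G x :|: (dx G x :\ a).
    by apply/setP => b; move: adx; rewrite !inE; case: eqP => [->->|_ _] //=; rewrite orNb.
  rewrite !ZpartE mulr_sumr; apply: ler_sum => s _.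
  rewrite weightU; last by rewrite disjoints_subset setCS subsetDl.
  rewrite mulrC ler_wpM2r ?(ltW (weight_gt0 K1 hK _ _)) //.
  have cD : (#|dx G x :\ a| <= D)%N.
    by apply: leq_trans xD; apply/subset_leq_card/subsetDl.
  by case/andP: (weight_bounds K1 hK s cD).
have aH : a \notin ~: dx G x :|: B by rewrite inE negb_or inE adx.
have := insert_constraint i w aH; rewrite ax setUCA => h.
have -> : cavity G x w (a |: B) - theta a i w * cavity G x w B =
  #|Omega|%:R / Zpart G (~: dx G x) *
  ((\sum_(s : config | s x == w) weight G (~: dx G x :|: (a |: B)) s)
     - theta a i w * \sum_(s : config | s x == w) weight G (~: dx G x :|: B) s).
  by rewrite /cavity; ring.
rewrite normrM ger0_norm; last by rewrite divr_ge0 // ltW.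
apply: le_trans (ler_wpM2l _ h) _; first by rewrite divr_ge0 // ltW.
have hd : (\sum_tau gap a i (~: dx G x :|: B) tau) / Zpart G (setT :\ a)
     <= discrepancy a i.
  rewrite /discrepancy ax (bigD1 B) /=; last first.
    by rewrite powersetE subsetD1 Bx.
  rewrite mulr_suml lerDl; apply: sumr_ge0 => C _; apply: sumr_ge0 => tau _.
  by rewrite divr_ge0 ?gap_ge0 // ltW.
apply: le_trans (ler_wpM2l _ hd); last by rewrite !mulr_ge0 ?exprn_ge0 // ltW.
set g := \sum_tau _; have g0 : 0 <= g by apply: sumr_ge0 => tau _; apply: gap_ge0.
rewrite exprS [leLHS](_ : _ = K * #|Omega|%:R * g * (Zpart G (~: dx G x))^-1); last by ring.
rewrite [leRHS](_ : _ = K * #|Omega|%:R * g * (K ^+ D / Zpart G (setT :\ a))); last by ring.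
apply: ler_wpM2l; first by rewrite !mulr_ge0 // ltW.
by rewrite ler_pdivlMr // mulrC ler_pdivrMr.
Qed.

(** Approximate multiplicativity of the cavity values contributes K ^+ D * (1 + K ^+ D); normalising
    contributes 2 and one more K ^+ D, as every cavity value is at least the inverse of K ^+ D. *)
Lemma var_error_le D x a : (#|dx G x| <= D)%N -> a \in dx G x ->
  \sum_w `|msg_va G x a w - var_update G x a w| <=
  2 * K ^+ D * K ^+ D * (1 + K ^+ D) * \sum_(b in dx G x) slack D x b.
Proof.
move=> xD ax.
pose B := dx G x :\ a; have Bx : B \subset dx G x by apply: subsetDl.
have BD : (#|B| <= D)%N by apply: leq_trans xD; apply: subset_leq_card.
pose p w := cavity G x w B; pose q w := \prod_(b in B) cavity G x w [set b].
have cb w (C : {set 'I_m}) : C \subset dx G x -> (K ^+ D)^-1 <= cavity G x w C <= K ^+ D.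
  move=> Cx; apply: (cavity_bounds K1 hK) => //.
  by apply: leq_trans xD; apply: subset_leq_card.
have V0 : 0 < (K ^+ D)^-1 by rewrite invr_gt0 exprn_gt0.
have c0 w (C : {set 'I_m}) : C \subset dx G x -> 0 <= cavity G x w C.
  by move=> /(cb w)/andP[h _]; apply: le_trans h; rewrite ltW.
have pq w : `|p w - q w| <= K ^+ D * (1 + K ^+ D) * \sum_(b in dx G x) slack D x b.
  (* Any position of b holding x will do, because [slack] sums over all of them; the default 0 never
     occurs for b in [dx G x]. *)
  pose th b := if [pick i | ft G b i == x] is Some i then theta b i w else 0.
  have := @almost_multiplicative _ _ (cavity G x w) th (slack D x) (dx G x) K (K ^+ D)
     K1 (cavity0 K1 hK Omega_gt0 x w).
  move=> /(_ _ _ _ B Bx) H; apply: le_trans (H _ _ _) _ => //.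
  - by move=> C Cx; rewrite c0 //=; case/andP: (cb w C Cx).
  - move=> b bx; have bx1 : [set b] \subset dx G x by rewrite sub1set.
    rewrite c0 //=; have b1 : (#|[set b]| <= 1)%N by rewrite cards1.
    by case/andP: (cavity_bounds K1 hK Omega_gt0 w bx1 b1); rewrite expr1.
  - move=> b C bx Cx bC; rewrite /th; case: pickP => [i /eqP bi|none].
      exact: cavity_insert.
    by move: bx; rewrite inE => /imsetP[i _ xi]; have := none i; rewrite -xi eqxx.
  have S0 : \sum_(b in B) slack D x b <= \sum_(b in dx G x) slack D x b.
    by rewrite [leRHS](big_setD1 a ax) /= lerDr slack_ge0.
  apply: ler_pM => //; try exact: ler_wpM2r.
  - by rewrite mulr_ge0 ?exprn_ge0 ?addr_ge0 ?exprn_ge0 // ltW.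
  - by apply: sumr_ge0 => b _; apply: slack_ge0.
  by rewrite ler_wpM2r ?addr_ge0 ?exprn_ge0 ?ler_weXn2l // ltW.
have sp : #|Omega|%:R * (K ^+ D)^-1 <= \sum_w p w.
  rewrite mulr_natl -sumr_const ler_sum // => w _; by case/andP: (cb w B Bx).
have O0 : 0 < #|Omega|%:R :> R by rewrite ltr0n.
have sp0 : 0 < \sum_w p w by apply: lt_le_trans sp; rewrite mulr_gt0.
under eq_bigr => w _ do
  rewrite (msg_va_cavity K1 hK Omega_gt0 _ ax) (var_update_cavity K1 hK Omega_gt0).
apply: le_trans (sum_normalize_le (p := p) (q := q) _ _ sp0) _.
- by move=> w; apply: c0.
- by move=> w; apply: prodr_ge0 => b /setD1P[_ bx]; apply: c0; rewrite sub1set.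
rewrite ler_pdivrMr //.
set C := \sum_(b in _) _ in pq *.
have C0 : 0 <= C by apply: sumr_ge0 => b _; apply: slack_ge0.
apply: le_trans (_ : 2 * (#|Omega|%:R * (K ^+ D * (1 + K ^+ D) * C)) <= _).
  by rewrite ler_wpM2l // mulr_natl -sumr_const ler_sum.
apply: le_trans (ler_wpM2l _ sp); last first.
  by rewrite !mulr_ge0 ?addr_ge0 ?exprn_ge0 // ltW.
rewrite le_eqVlt; apply/orP; left; apply/eqP; field.
by rewrite expf_neq0 // gt_eqF.
Qed.

(** The factor equation is the insertion of a into the empty set, whose cavity value is 1. *)
Lemma fac_error_le D x a i : (#|dx G x| <= D)%N -> ft G a i = x ->
  \sum_w `|msg_av G x a w - theta a i w / \sum_t theta a i t|
  <= 2 * K * slack D x a.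
Proof.
move=> xD ax.
have adx : a \in dx G x by rewrite inE -ax mem_vars.
have a1 : [set a] \subset dx G x by rewrite sub1set.
have cb w : (K ^+ 1)^-1 <= cavity G x w [set a].
  have c1 : (#|[set a]| <= 1)%N by rewrite cards1.
  by case/andP: (cavity_bounds K1 hK Omega_gt0 w a1 c1).
have V0 : 0 < K^-1 by rewrite invr_gt0.
have O0 : 0 < #|Omega|%:R :> R by rewrite ltr0n.
have sp : #|Omega|%:R * K^-1 <= \sum_w cavity G x w [set a].
  by rewrite mulr_natl -sumr_const ler_sum // => w _; rewrite -[K]expr1.
have sp0 : 0 < \sum_w cavity G x w [set a] by apply: lt_le_trans sp; rewrite mulr_gt0.
under eq_bigr => w _ do rewrite (msg_av_cavity K1 hK Omega_gt0).
apply: le_trans (sum_normalize_le (p := fun w => cavity G x w [set a]) _ _ sp0) _.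
- by move=> w; apply: le_trans (cb w); rewrite expr1 ltW.
- by move=> w; apply: theta_ge0.
rewrite ler_pdivrMr //.
apply: le_trans (_ : 2 * (#|Omega|%:R * slack D x a) <= _).
  rewrite ler_wpM2l // mulr_natl -sumr_const ler_sum // => w _.
  have := cavity_insert w xD ax (sub0set _) (negbT (in_set0 a)).
  by rewrite setU0 (cavity0 K1 hK Omega_gt0) mulr1.
apply: le_trans (ler_wpM2l _ sp); last by rewrite !mulr_ge0 ?slack_ge0 // ltW.
by rewrite le_eqVlt; apply/orP; left; apply/eqP; field; rewrite gt_eqF.
Qed.
End LocalError.

Lemma sum_normalize_le1 (T : finType) (q : T -> R) :
  \sum_t q t / (\sum_u q u) <= 1.
Proof.
rewrite -mulr_suml; have [->|q0] := eqVneq (\sum_t q t) 0; first by rewrite mul0r.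
by rewrite divff.
Qed.

Section BPError.
Variables (Omega : finType) (k n m : nat) (G : Defs.fgraph Omega k n m).
Local Notation config := {ffun 'I_n -> Omega}.
Local Notation loc := {ffun 'I_k -> Omega}.
Variable K : R.
Hypotheses (K1 : 1 <= K) (hK : forall a tau, K^-1 <= fw G a tau <= K).
Hypothesis Omega_gt0 : (0 < #|Omega|)%N.

Let K_gt0 : 0 < K. Proof. by apply: lt_le_trans K1. Qed.

Lemma fac_term_ge0 x a tau : 0 <= @fac_term _ _ _ _ G x a tau.
Proof.
rewrite /fac_term RmultE mulr_ge0 ?(fw_ge0 K1 hK) // rprod_big prodr_ge0 // => y _.
exact: (marg_ge0 K1 hK).
Qed.

Lemma fac_updateE x a w (xa : x \in vars (ft G a)) :
  fac_update G x a w =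
  (\sum_(tau : {ffun vsub (ft G a) -> Omega} | tau (exist _ x xa) == w)
     fac_term x tau) / \sum_(tau : {ffun vsub (ft G a) -> Omega}) fac_term x tau.
Proof.
rewrite /fac_update RdivE rsum_filter_enum rsum_enum; congr (_ / _).
apply: eq_bigl => tau; apply/existsP/eqP => [[y /andP[/eqP yx /eqP <-]]|<-].
  by congr (tau _); apply: val_inj; rewrite /= yx.
by exists (exist _ x xa); rewrite /= !eqxx.
Qed.

Lemma fac_dist_le2 x a : x \in vars (ft G a) ->
  \sum_w `|msg_av G x a w - fac_update G x a w| <= 2.
Proof.
move=> xa; apply: sum_dist_normalize_le2.
- by move=> w; apply: (marg_ge0 K1 hK).
- move=> w; rewrite (fac_updateE w xa) divr_ge0 // sumr_ge0 // => t _; exact: fac_term_ge0.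
- by rewrite (marg_sum1 K1 hK).
under eq_bigr do rewrite (fac_updateE _ xa).
rewrite -mulr_suml.
have <- : \sum_(tau : {ffun vsub (ft G a) -> Omega}) fac_term x tau =
  \sum_w \sum_(tau : {ffun vsub (ft G a) -> Omega} | tau (exist _ x xa) == w)
     fac_term x tau.
  by rewrite (partition_big (fun tau : {ffun vsub (ft G a) -> Omega} =>
     tau (exist _ x xa)) predT).
rewrite mulr_suml; exact: sum_normalize_le1.
Qed.

Lemma var_dist_le2 x a :
  \sum_w `|msg_va G x a w - var_update G x a w| <= 2.
Proof.
have prod0 w : 0 <= \prod_(b in dx G x :\ a) msg_av G x b w.
  by apply: prodr_ge0 => b _; apply: (marg_ge0 K1 hK).
have vE w : var_update G x a w = (\prod_(b in dx G x :\ a) msg_av G x b w) /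
    \sum_t \prod_(b in dx G x :\ a) msg_av G x b t.
  rewrite /var_update RdivE rprod_enum rsum_enum; congr (_ / _).
  by apply: eq_bigr => t _; rewrite rprod_enum.
apply: sum_dist_normalize_le2.
- by move=> w; apply: (marg_ge0 K1 hK).
- by move=> w; rewrite vE divr_ge0 ?sumr_ge0.
- by rewrite (marg_sum1 K1 hK).
under eq_bigr do rewrite vE.
exact: sum_normalize_le1.
Qed.

(* For an injective tuple, assignments of the set of variables at a are
   assignments of the k positions. *)
Lemma fac_update_theta x a i w : injective (ft G a) -> ft G a i = x ->
  fac_update G x a w = theta G a i w / \sum_t theta G a i t.
Proof.
move=> inj ax.
have xa : x \in vars (ft G a) by rewrite -ax mem_vars.
pose e j : vsub (ft G a) := exist _ (ft G a j) (mem_vars (ft G a) j).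
have e_inj : injective e by move=> j j' /(congr1 val) /= /inj.
have e_bij : bijective e.
  apply: inj_card_bij => //.
  rewrite card_sig; apply: leq_trans (leq_imset_card (ft G a) predT).
  by apply: subset_leq_card; apply/subsetP => y; rewrite inE.
have [e' eK e'K] := e_bij.
pose up (th : loc) : {ffun vsub (ft G a) -> Omega} := [ffun y => th (e' y)].
pose dn (tau : {ffun vsub (ft G a) -> Omega}) : loc := [ffun j => tau (e j)].
have upK : cancel up dn by move=> th; apply/ffunP => j; rewrite !ffunE eK.
have dnK : cancel dn up by move=> tau; apply/ffunP => y; rewrite !ffunE e'K.
have term (th : loc) : fac_term x (up th) = fw G a th * prod_marg G a i th.
  rewrite /fac_term RmultE; congr (_ * _).
    rewrite /psi_tau; congr fw; apply/ffunP => j; rewrite !ffunE.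
    by rewrite -[exist _ _ _]/(e j) eK.
  rewrite rprod_big big_filter big_enum_cond /= /prod_marg (reindex e) /=; last first.
    by exists e' => y _; [apply: eK | apply: e'K].
  apply: eq_big => [j|j _]; first by rewrite -ax (inj_eq inj).
  by rewrite ffunE eK.
have ei : exist _ x xa = e i by apply: val_inj; rewrite /= ax.
have upbij : {on predT, bijective up} by exists dn => y _; [apply: upK | apply: dnK].
rewrite (fac_updateE w xa); congr (_ / _).
  rewrite (reindex up) /=; last exact: onW_bij (Bijective upK dnK).
  apply: eq_big => [th|th _]; last exact: term.
  by rewrite ei ffunE eK.
rewrite (reindex up) /=; last exact: onW_bij (Bijective upK dnK).
rewrite (partition_big (fun th : loc => th i) predT) //=.
by apply: eq_bigr => t _; apply: eq_bigr => th _; apply: term.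
Qed.

(** 2 * K comes from the factor equation. The variable equation of every message leaving x involves
    the slack of all constraints at x, so each slack is counted up to D times. The last factor is
    the one in [slack]. *)
Definition error_factor (D : nat) : R :=
  ((2 * K + D%:R * (2 * K ^+ D * K ^+ D * (1 + K ^+ D)))
   * (K ^+ D.+1 * #|Omega|%:R))%R.

(** The trivial bound 2 for either equation gives 4 at a variable of high degree, and 2 for the
    factor equation at a tuple with a repetition. *)
Definition local_error (D : nat) (a : 'I_m) (i : 'I_k) : R :=
  (4 * (D < #|dx G (ft G a i)|)%:R + 2 * (~~ injectiveb (ft G a))%:R
   + error_factor D * ((#|dx G (ft G a i)| <= D)%:R * discrepancy G a i))%R.

Lemma error_factor_ge0 D : 0 <= error_factor D.
Proof.
have K0 := ltW K_gt0.
rewrite /error_factor; apply: mulr_ge0; last by rewrite !mulr_ge0 ?exprn_ge0.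
apply: addr_ge0; first exact: mulr_ge0.
by rewrite !mulr_ge0 ?addr_ge0 ?exprn_ge0.
Qed.

(** A pair (x, a) is charged to all positions of a that hold x; there is at least one, and all
    charges are nonnegative. *)
Lemma bp_err_le D :
  bp_err G <= \sum_(a : 'I_m) \sum_(i : 'I_k) local_error D a i.
Proof.
pose eV x a : R := \sum_w `|msg_va G x a w - var_update G x a w|.
pose eF x a : R := \sum_w `|msg_av G x a w - fac_update G x a w|.
have -> : bp_err G = \sum_x \sum_(a in dx G x) (eV x a + eF x a).
  rewrite /bp_err rsum_enum; apply: eq_bigr => x _; rewrite rsum_enum.
  apply: eq_bigr => a _; rewrite rsum_enum -big_split.
  by apply: eq_bigr => w _; rewrite !RabsE !RminusE RplusE.
have -> : \sum_(a : 'I_m) \sum_(i : 'I_k) local_error D a i =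
   \sum_(x : 'I_n) \sum_(a in dx G x) \sum_(i | ft G a i == x) local_error D a i.
  transitivity (\sum_(x : 'I_n) \sum_(a : 'I_m) \sum_(i | ft G a i == x) local_error D a i).
    rewrite [RHS]exchange_big; apply: eq_bigr => a _.
    by rewrite (partition_big (ft G a) predT).
  apply: eq_bigr => x _; rewrite [RHS]big_mkcond; apply: eq_bigr => a _.
  case: ifP => // /negP xa; rewrite big1 // => i /eqP xi.
  by case: xa; rewrite inE -xi mem_vars.
apply: ler_sum => x _.
have ex a : a \in dx G x -> exists i, ft G a i == x.
  by rewrite inE => /imsetP[i _ ->]; exists i.
have sum_ge a (c : R) (f : 'I_k -> R) : a \in dx G x -> 0 <= c ->
    (forall i, ft G a i == x -> c <= f i) -> c <= \sum_(i | ft G a i == x) f i.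
  move=> /ex[i xi] c0 cf; rewrite (bigD1 i) //= -[leLHS]addr0; apply: lerD; first exact: cf.
  by apply: sumr_ge0 => j /andP[xj _]; apply: le_trans (cf j xj).
have disc0 a i := discrepancy_ge0 K1 hK a i.
have eF2 a : a \in dx G x -> eF x a <= 2 by rewrite inE => /fac_dist_le2.
case: (leqP #|dx G x| D) => [xD|xD]; last first.
  apply: ler_sum => a ax; apply: le_trans (_ : 4 <= _).
    by have := eF2 a ax; have := var_dist_le2 x a; rewrite /eV; lra.
  apply: sum_ge => // i /eqP xi; rewrite /local_error xi xD mulr1 -addrA lerDl.
  apply: addr_ge0; first exact: mulr_ge0.
  apply: mulr_ge0; first exact: error_factor_ge0.
  by apply: mulr_ge0 => //; apply: disc0.
pose c : R := 2 * K ^+ D * K ^+ D * (1 + K ^+ D).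
have K0 := ltW K_gt0.
have c0 : 0 <= c by rewrite /c !mulr_ge0 ?addr_ge0 ?exprn_ge0.
have sl0 a : 0 <= slack G K D x a by apply: slack_ge0.
have hV : \sum_(a in dx G x) eV x a <= D%:R * c * \sum_(a in dx G x) slack G K D x a.
  apply: le_trans (_ : \sum_(a in dx G x) (c * \sum_(b in dx G x) slack G K D x b) <= _).
    by apply: ler_sum => a ax; apply: var_error_le.
  rewrite sumr_const -[leLHS]mulr_natl mulrA !ler_wpM2r ?sumr_ge0 //.
  by rewrite ler_nat.
have hF a : a \in dx G x -> eF x a <= 2 * (~~ injectiveb (ft G a))%:R + 2 * K * slack G K D x a.
  move=> ax; case: injectiveP => [inj|_]; last first.
    by rewrite mulr1; apply: le_trans (eF2 a ax) _; rewrite lerDl !mulr_ge0.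
  rewrite mulr0 add0r; have [i /eqP xi] := ex a ax.
  rewrite /eF; under eq_bigr do rewrite (fac_update_theta _ inj xi).
  exact: fac_error_le.
rewrite big_split /=.
apply: le_trans (_ : \sum_(a in dx G x) (2 * (~~ injectiveb (ft G a))%:R
   + (2 * K + D%:R * c) * slack G K D x a) <= _).
  apply: le_trans (lerD hV (ler_sum _ hF)) _.
  rewrite !big_split /= -!mulr_sumr le_eqVlt; apply/orP; left; apply/eqP; ring.
apply: ler_sum => a ax.
under [leRHS]eq_bigr => i /eqP xi do rewrite /local_error xi ltnNge xD /= mulr0 add0r mul1r.
rewrite big_split /=; apply: lerD.
  apply: sum_ge => //; exact: mulr_ge0.
rewrite /slack mulr_sumr; apply: ler_sum => i _.
by rewrite /error_factor mulrA.
Qed.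
End BPError.

(** * Averaging over the tuple of one constraint *)

Lemma tvE (T : finType) (p q : T -> R) :
  tv p q = 2^-1 * \sum_t `|p t - q t|.
Proof.
by rewrite /tv RmultE RinvE rsum_enum; congr (_^-1 * _).
Qed.

Lemma tv_ge0 (T : finType) (p q : T -> R) : 0 <= tv p q.
Proof. by rewrite tvE mulr_ge0 ?invr_ge0 // sumr_ge0. Qed.

Section OneConstraint.
Variables (Omega : finType) (k n m : nat) (G : Defs.fgraph Omega k n m) (a : 'I_m).
Local Notation config := {ffun 'I_n -> Omega}.
Local Notation loc := {ffun 'I_k -> Omega}.
Local Notation tup := {ffun 'I_k -> 'I_n}.
Implicit Types (A B : {set 'I_m}) (s : config) (x : 'I_n) (w : Omega) (t : tup).

Definition rs_on A : R :=
  ((\sum_x \sum_y tv (marg2 G A x y) (fun p => marg G A x p.1 * marg G A y p.2))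
   / n%:R ^+ 2)%R.

Definition others x : {set 'I_m} := dx G x :\ a.

Definition remaining x B : {set 'I_m} := (setT :\ a) :\: others x :|: B.

Definition gap_at t (i : 'I_k) x B (tau : loc) : R :=
  (`|\sum_(s : config | cval t s == tau) weight G (remaining x B) s
     - (\prod_(j | j != i) marg G (setT :\ a) (t j) (tau j)) *
       \sum_(s : config | s x == tau i) weight G (remaining x B) s|
   / Zpart G (setT :\ a))%R.

(* local_error as a function of the tuple t put at a, the rest of G being fixed;
   others x and remaining x B do not depend on t. *)
Definition error_at (K : R) (D : nat) (i : 'I_k) t : R :=
  (4 * (D <= #|others (t i)|)%:R + 2 * (~~ injectiveb t)%:R
   + error_factor Omega K D * ((#|others (t i)| < D)%:R *
       \sum_(B in powerset (others (t i))) \sum_(tau : loc)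
          gap_at t i (t i) B tau))%R.

Variable G' : Defs.fgraph Omega k n m.
Hypotheses (fwG' : forall b, b != a -> fw G' b = fw G b)
           (ftG' : forall b, b != a -> ft G' b = ft G b).

Lemma weight_agree A s : a \notin A -> weight G' A s = weight G A s.
Proof.
move=> aA; rewrite !weightE; apply: eq_bigr => b bA.
have ba : b != a by apply: contraNneq aA => <-.
by rewrite fwG' // ftG'.
Qed.

Lemma Zpart_agree A : a \notin A -> Zpart G' A = Zpart G A.
Proof. by move=> aA; rewrite !ZpartE; apply: eq_bigr => s _; apply: weight_agree. Qed.

Lemma marg_agree A x w : a \notin A -> marg G' A x w = marg G A x w.
Proof.
move=> aA; rewrite !margE Zpart_agree //; congr (_ / _).
by apply: eq_bigr => s _; apply: weight_agree.
Qed.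

Lemma others_agree x : dx G' x :\ a = others x.
Proof.
by apply/setP => b; rewrite !inE; case: eqP => //= /eqP ba; rewrite ftG'.
Qed.

(** All Gibbs sums in [local_error] avoid a, so of the constraint a only its tuple matters and can
    be resampled with the rest fixed. The degree counts a itself, which turns D < #|dx| into D <=
    #|others|. *)
Lemma local_error_agree (K : R) D i :
  local_error G' K D a i = error_at K D i (ft G' a).
Proof.
set t := ft G' a; have adx : a \in dx G' (t i) by rewrite inE mem_vars.
have cdx : #|dx G' (t i)| = #|others (t i)|.+1.
  by rewrite (cardsD1 a) adx others_agree.
have a0 : a \notin setT :\ a by rewrite !inE eqxx.
rewrite /local_error /error_at /discrepancy -/t cdx ltnS.
rewrite [(_.+1 <= D)%N]/((_ < D)%N) others_agree.
congr (_ + _ * (_ * _)); apply: eq_bigr => B; rewrite powersetE => BS.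
apply: eq_bigr => tau _; rewrite /gap_at Zpart_agree //; congr (_ / _).
have -> : ~: dx G' (t i) :|: B = remaining (t i) B.
  apply/setP => b; rewrite /remaining -others_agree !inE.
  by case: (b =P a) => [->|]; rewrite ?mem_vars //= andbT.
have aR : a \notin remaining (t i) B.
  rewrite !inE eqxx /=; apply/negP => /(subsetP BS).
  by rewrite !inE eqxx.
rewrite /gap -/t; congr (`|_ - _ * _|).
- by apply: eq_bigr => s _; apply: weight_agree.
- by apply: eq_bigr => j _; apply: marg_agree.
by apply: eq_bigr => s _; apply: weight_agree.
Qed.
End OneConstraint.

Section Averaging.
Variables (Omega : finType) (k n m : nat) (G : Defs.fgraph Omega k n m) (a : 'I_m).
Local Notation config := {ffun 'I_n -> Omega}.
Local Notation loc := {ffun 'I_k -> Omega}.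
Local Notation tup := {ffun 'I_k -> 'I_n}.
Variables (K eta : R) (D : nat).
Hypotheses (K1 : 1 <= K) (hK : forall b tau, K^-1 <= fw G b tau <= K).
Hypotheses (Omega_gt0 : (0 < #|Omega|)%N) (n_gt0 : (0 < n)%N) (eta_gt0 : 0 < eta).

Let K_gt0 : 0 < K. Proof. by apply: lt_le_trans K1. Qed.
Let n0 : 0 < n%:R :> R. Proof. by rewrite ltr0n. Qed.
Local Notation A0 := (setT :\ a).
Let Z0 : 0 < Zpart G A0. Proof. exact: (Zpart_gt0 K1 hK). Qed.

Definition gibbs (s : config) : R := (weight G A0 s / Zpart G A0)%R.

Lemma gibbs_ge0 s : 0 <= gibbs s.
Proof. by rewrite divr_ge0 ?ltW ?(weight_gt0 K1 hK). Qed.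

Lemma gibbs_sum : \sum_s gibbs s = 1.
Proof. by rewrite -mulr_suml -ZpartE divff // gt_eqF. Qed.

Definition spin (tau : loc) (j : 'I_k) (y : 'I_n) (s : config) : R :=
  ((s y == tau j)%:R)%R.

Lemma expect_spin tau j y : expect gibbs (spin tau j y) = marg G A0 y (tau j).
Proof.
rewrite margE mulr_suml [RHS]big_mkcond; apply: eq_bigr => s _.
by rewrite /spin /gibbs; case: eqP; rewrite ?mulr1 ?mulr0.
Qed.

(** The covariance is a single coordinate of the difference between joint law and product; 2 undoes
    the 1/2 in [tv]. *)
Lemma cov_spin_le tau j y z :
  `|cov gibbs (spin tau j y) (spin tau j z)| <=
  2 * tv (marg2 G A0 y z) (fun p => marg G A0 y p.1 * marg G A0 z p.2)%R.
Proof.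
rewrite tvE mulrA divff ?mul1r ?pnatr_eq0 //.
have -> : cov gibbs (spin tau j y) (spin tau j z) =
    marg2 G A0 y z (tau j, tau j) - marg G A0 y (tau j) * marg G A0 z (tau j).
  rewrite /cov !expect_spin; congr (_ - _).
  rewrite marg2E mulr_suml [RHS]big_mkcond; apply: eq_bigr => s _ /=.
  by rewrite /spin /gibbs; do 2!case: eqP => _ /=; rewrite ?mulr1 ?mulr0.
rewrite (bigD1 (tau j, tau j)) //= lerDl.
by apply: sumr_ge0.
Qed.

(** The bound of [sum_cov_le] per variable, for c = eta * n and M = K ^+ D. *)
Definition beta : R := ((eta * (K ^+ D) ^+ 2 + 2 * rs_on G A0 / eta) / 2)%R.

Lemma sum_cov_spin_le tau j (F : config -> R) : (forall s, `|F s| <= K ^+ D) ->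
  \sum_y `|cov gibbs (spin tau j y) F| <= n%:R * beta.
Proof.
move=> FM; have en : 0 < eta * n%:R by rewrite mulr_gt0.
apply: le_trans (sum_cov_le gibbs_ge0 gibbs_sum (spin tau j) en FM) _.
apply: le_trans (_ : (eta * n%:R * (K ^+ D) ^+ 2 +
   (2 * (rs_on G A0 * n%:R ^+ 2)) / (eta * n%:R)) / 2 <= _); last first.
  rewrite /beta le_eqVlt; apply/orP; left; apply/eqP; field.
  by rewrite !gt_eqF.
rewrite ler_pM2r ?invr_gt0 // lerD2l ler_pM2r ?invr_gt0 //.
rewrite /rs_on divfK ?expf_neq0 ?gt_eqF // mulr_sumr; apply: ler_sum => y _.
by rewrite mulr_sumr; apply: ler_sum => z _; apply: cov_spin_le.
Qed.

Lemma rs_on_ge0 : 0 <= rs_on G A0.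
Proof.
rewrite /rs_on divr_ge0 ?exprn_ge0 //; apply: sumr_ge0 => y _; apply: sumr_ge0 => z _.
exact: tv_ge0.
Qed.

Lemma beta_ge0 : 0 <= beta.
Proof.
apply: divr_ge0 => //; apply: addr_ge0.
  by apply: mulr_ge0; [apply: ltW | apply: sqr_ge0].
apply: divr_ge0; last exact: ltW.
by apply: mulr_ge0 => //; apply: rs_on_ge0.
Qed.

(** Dividing the indicator of s x = tau i by the weight of the deleted set C turns a Gibbs
    expectation in G - a into a sum of weights of the remaining graph. So [gap_at] is exactly the
    factorisation error of [sum_prod_cov_le] over the positions j != i, and fewer than D deletions
    keep F below K ^+ D. *)
Lemma sum_gap_at_le (i : 'I_k) (x : 'I_n) (B : {set 'I_m}) (tau : loc) :
  (#|others G a x| < D)%N -> B \subset others G a x ->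
  \sum_(t : tup) (t i == x)%:R * gap_at G a t i x B tau <=
  k%:R * beta * \sum_(t : tup) (t i == x)%:R.
Proof.
move=> xD Bx.
pose C := others G a x :\: B.
have A0E : A0 = remaining G a x B :|: C.
  apply/setP => b; have := subsetP Bx b; rewrite !inE.
  by case: (b \in B); case: (b == a) => //=; case: (x \in vars (ft G b)) => // /(_ isT).
have dis : [disjoint remaining G a x B & C].
  rewrite -setI_eq0; apply/eqP/setP => b; rewrite !inE.
  by case: (b \in B); case: (b == a) => //=; rewrite ?andbF //; case: (x \in vars (ft G b)).
have CD : (#|C| <= D)%N.
  by apply: leq_trans (ltnW xD); apply/subset_leq_card/subsetDl.
have wC s : weight G A0 s = weight G (remaining G a x B) s * weight G C s.
  by rewrite A0E weightU.
have wC0 s : 0 < weight G C s by apply: (weight_gt0 K1 hK).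
pose F (s : config) : R := (s x == tau i)%:R / weight G C s.
have FM s : `|F s| <= K ^+ D.
  rewrite /F normrM normfV (gtr0_norm (wC0 s)) ler_pdivrMr //.
  have /andP[h _] := weight_bounds K1 hK s CD.
  apply: le_trans (_ : 1 <= _); first by rewrite normr_nat lern1 leq_b1.
  by rewrite -(ler_pM2l (exprn_gt0 D K_gt0)) mulfV ?gt_eqF ?exprn_gt0 in h.
pose J := [seq j <- enum 'I_k | j != i].
have Jprod (f : 'I_k -> R) : \prod_(j <- J) f j = \prod_(j | j != i) f j.
  by rewrite big_filter big_enum_cond.
have FZ (P : pred config) (f : config -> R) :
    (forall s, f s = (P s)%:R / weight G C s) ->
    expect gibbs f = (\sum_(s : config | P s) weight G (remaining G a x B) s) / Zpart G A0.
  move=> fP; rewrite mulr_suml [RHS]big_mkcond; apply: eq_bigr => s _.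
  rewrite fP /gibbs wC; case: (P s) => /=; rewrite ?mul0r ?mulr0 //.
  by field; rewrite !gt_eqF.
have := @sum_prod_cov_le _ _ _ _ gibbs (spin tau) (K ^+ D) (n%:R * beta)
   gibbs_ge0 gibbs_sum _ _ J i x F _ _ FM.
rewrite card_ord => H.
have {}H : n%:R * \sum_(t : tup) (t i == x)%:R * gap_at G a t i x B tau <=
    (size J)%:R * (n%:R * beta * \sum_(t : tup) (t i == x)%:R).
  apply: le_trans (H _ _ _ _).
  - apply: ler_wpM2l => //; apply: ler_sum => t _.
    case: eqP => [tx|_]; rewrite ?mul0r // !mul1r.
    rewrite /gap_at -{1}[Zpart _ _](gtr0_norm Z0) -normfV -normrM mulrBl.
    rewrite le_eqVlt; apply/orP; left; apply/eqP; congr (`|_ - _|).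
      rewrite (FZ (fun s : config => cval t s == tau)) // => s.
      rewrite /F mulrA; congr (_ / _); rewrite Jprod /spin.
      case: (cval t s =P tau) => [<-|ne]; last first.
        have [j nj] : exists j, cval t s j != tau j.
          apply/existsP; rewrite -negb_forall; apply/negP => /forallP h.
          by apply: ne; apply/ffunP => j; apply/eqP.
        move: nj; rewrite ffunE; have [->|ji] := eqVneq j i.
          by rewrite tx => /negPf ->; rewrite mulr0.
        by move=> nj; rewrite (bigD1 j) //= (negPf nj) !mul0r.
      rewrite ffunE tx eqxx mulr1 big1 // => j _.
      by rewrite ffunE eqxx.
    rewrite -mulrA; congr (_ * _).
      by rewrite Jprod; apply: eq_bigr => j _; rewrite expect_spin.
    by rewrite (FZ (fun s : config => s x == tau i)).
  - by move=> j y s; rewrite /spin; case: eqP; rewrite lexx ler01.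
  - by move=> j F' F'M; apply: sum_cov_spin_le.
  - by rewrite filter_uniq // enum_uniq.
  - by rewrite mem_filter eqxx.
have sJ : (size J <= k)%N by rewrite size_filter -[X in (_ <= X)%N](size_enum_ord k) count_size.
rewrite -(ler_pM2l n0); apply: le_trans H _.
set N := \sum_(t : tup) _; have N0 : 0 <= N by apply: sumr_ge0.
rewrite [leRHS](_ : _ = k%:R * (n%:R * beta * N)); last by ring.
apply: ler_wpM2r; last by rewrite ler_nat.
by apply: mulr_ge0 => //; apply: mulr_ge0 => //; apply: beta_ge0.
Qed.

(** Markov's inequality for the degree of the uniform variable t i: the m.-1 other constraints
    contribute at most k each to the sum of the degrees. *)
Lemma sum_others_le (i : 'I_k) :
  n%:R * \sum_(t : tup) (D <= #|others G a (t i)|)%:R * D%:R <=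
  (k * m.-1)%:R * n%:R ^+ k :> R.
Proof.
rewrite -[n in n%:R * _]card_ord -(resample_unif i).
under eq_bigr do under eq_bigr do rewrite upd_same.
rewrite sumr_const card_ffun !card_ord -[leLHS]mulr_natr natrX.
apply: ler_wpM2r; first exact: exprn_ge0.
apply: le_trans (_ : \sum_(y : 'I_n) #|others G a y|%:R <= _).
  apply: ler_sum => y _; case: leqP => h; rewrite ?mul0r // mul1r.
  by rewrite ler_nat.
rewrite -natr_sum ler_nat.
under eq_bigr do rewrite -sum1_card big_mkcond.
rewrite exchange_big /=.
apply: leq_trans (_ : \sum_(b in A0) k <= _)%N; last first.
  by rewrite sum_nat_const mulnC setTD cardsC1 card_ord.
rewrite [X in (_ <= X)%N]big_mkcond /=; apply: leq_sum => b _.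
rewrite !inE; case: eqP => [->|/eqP ba] /=.
  by rewrite big1 // => y _; rewrite !inE eqxx.
under eq_bigr do rewrite !inE ba /=.
rewrite -big_mkcond sum1_card.
by apply: leq_trans (leq_imset_card _ _) _; rewrite card_ord.
Qed.

(** The three terms come from large degree, repetition and gap; 2 ^+ D bounds the number of sets B,
    and #|Omega| ^+ k is the number of local assignments. *)
Lemma sum_error_at_le (i : 'I_k) : (0 < D)%N ->
  \sum_(t : tup) error_at G a K D i t <=
  n%:R ^+ k * (4 * (k * m.-1)%:R / (n%:R * D%:R) + 2 * (k ^ 2)%:R / n%:R
    + error_factor Omega K D * (2 ^+ D * #|Omega|%:R ^+ k * (k%:R * beta))).
Proof.
move=> D0; rewrite !big_split /= -!mulr_sumr !mulrDr.
have D0' : 0 < D%:R :> R by rewrite ltr0n.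
apply: lerD; first apply: lerD.
- have := sum_others_le i; rewrite -mulr_suml => h.
  rewrite [leRHS](_ : _ = 4 * ((k * m.-1)%:R * n%:R ^+ k / (n%:R * D%:R))); last by ring.
  rewrite ler_wpM2l // ler_pdivlMr ?mulr_gt0 //; apply: le_trans h.
  by rewrite le_eqVlt; apply/orP; left; apply/eqP; ring.
- have := @sum_not_inj R 'I_k 'I_n; rewrite !card_ord => h.
  rewrite [leRHS](_ : _ = 2 * ((k ^ 2)%:R * n%:R ^+ k / n%:R)); last by ring.
  by rewrite ler_wpM2l // ler_pdivlMr // mulrC.
rewrite mulrCA ler_wpM2l ?error_factor_ge0 //.
pose c : R := (k%:R * beta)%R.
have c0 : 0 <= c by rewrite mulr_ge0 ?beta_ge0.
pose N x : R := \sum_(t : tup) (t i == x)%:R.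
have NE x : n%:R * N x = n%:R ^+ k.
  by have := @sum_coord_eq R _ 'I_n i x; rewrite !card_ord.
have N0 x : 0 <= N x by apply: sumr_ge0.
apply: le_trans (_ : \sum_(x : 'I_n) 2 ^+ D * #|Omega|%:R ^+ k * c * N x <= _); last first.
  rewrite -mulr_sumr -(ler_pM2l n0) [leLHS]mulrCA mulr_sumr.
  under eq_bigr do rewrite NE.
  rewrite sumr_const card_ord -[_ ^+ k *+ n]mulr_natl.
  rewrite le_eqVlt; apply/orP; left; apply/eqP; rewrite /c.
  by set u := 2 ^+ D; set v := #|Omega|%:R ^+ k; set z := n%:R ^+ k; ring.
(* The observable F must not vary with t, so the sum is split by the value x of t i. *)
apply: le_trans (_ : \sum_(x : 'I_n) \sum_(t : tup) (t i == x)%:R *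
   ((#|others G a x| < D)%:R * \sum_(B in powerset (others G a x))
      \sum_(tau : loc) gap_at G a t i x B tau) <= _).
  rewrite exchange_big /=; apply: ler_sum => t _.
  rewrite (bigD1 (t i)) //= eqxx mul1r lerDl; apply: sumr_ge0 => x _.
  rewrite !mulr_ge0 //; apply: sumr_ge0 => B _; apply: sumr_ge0 => tau _.
  by rewrite divr_ge0 // ltW.
apply: ler_sum => x _; case: ltnP => xD; last first.
  rewrite big1 => [|t _]; last by rewrite mul0r mulr0.
  by rewrite -mulrA; apply: mulr_ge0; apply: mulr_ge0 => //; apply: exprn_ge0.
under eq_bigr => t _ do rewrite mul1r mulr_sumr.
rewrite exchange_big /=.
apply: le_trans (_ : \sum_(B in powerset (others G a x)) \sum_(tau : loc) c * N x <= _).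
  apply: ler_sum => B; rewrite powersetE => Bx.
  under eq_bigr => t _ do rewrite mulr_sumr.
  rewrite exchange_big /=; apply: ler_sum => tau _.
  exact: sum_gap_at_le.
rewrite !sumr_const card_ffun card_ord card_powerset -mulrnA.
rewrite -[leLHS]mulr_natl natrM !natrX -[leRHS]mulrA; apply: ler_wpM2r.
  exact: mulr_ge0.
rewrite mulrC; apply: ler_wpM2r; first exact: exprn_ge0.
by apply: ler_weXn2l; [rewrite ler1n | apply: ltnW].
Qed.
End Averaging.

(** * The random factor graph *)

Lemma rs_stat_on (Omega : finType) (k n m : nat) (G : Defs.fgraph Omega k n m) :
  rs_stat G = rs_on G setT.
Proof.
rewrite /rs_stat /rs_on RmultE RinvE RpowE INRE mulrC rsum_enum; congr (_ / _).
by apply: eq_bigr => i _; rewrite rsum_enum.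
Qed.

Lemma rs_stat_ge0 (Omega : finType) (k n m : nat) (G : Defs.fgraph Omega k n m) :
  0 <= rs_stat G.
Proof.
rewrite rs_stat_on /rs_on divr_ge0 ?exprn_ge0 //.
by do 2!(apply: sumr_ge0 => ? _); apply: tv_ge0.
Qed.

Lemma bp_err_ge0 (Omega : finType) (k n m : nat) (G : Defs.fgraph Omega k n m) :
  0 <= bp_err G.
Proof.
rewrite /bp_err rsum_enum; apply: sumr_ge0 => x _; rewrite rsum_enum.
apply: sumr_ge0 => a _; rewrite rsum_enum; apply: sumr_ge0 => w _.
by rewrite !RabsE RplusE addr_ge0.
Qed.

Section RandomGraph.
Variables (Omega : finType) (k n : nat) (P : finType)
  (psi : P -> {ffun 'I_k -> Omega} -> R) (rho : P -> R).
Local Notation factor := (P * {ffun 'I_k -> 'I_n})%type.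
Local Notation config := {ffun 'I_n -> Omega}.

Definition factor_prob (v : factor) : R := (rho v.1 / n%:R ^+ k)%R.

Definition mean m (X : Defs.fgraph Omega k n m -> R) : R :=
  (\sum_(om : {ffun 'I_m -> factor})
    (\prod_b factor_prob (om b)) * X (graph_of psi om))%R.

Lemma EtermE d X m : Eterm psi rho d X m =
  poisson (d * INR n / INR k) m * mean (X m).
Proof.
rewrite /Eterm RmultE; congr (_ * _); rewrite /mean.
rewrite rsum_enum; apply: eq_bigr => om _; rewrite RmultE; congr (_ * _).
rewrite /sample_prob rprod_enum; apply: eq_bigr => b _.
by rewrite RdivE RpowE INRE.
Qed.

Hypotheses (rho_ge0 : forall p, 0 <= rho p) (rho_sum : \sum_p rho p = 1).

Lemma sum_factor_prob (f : {ffun 'I_k -> 'I_n} -> R) :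
  \sum_(v : factor) factor_prob v * f v.2 =
  (\sum_(t : {ffun 'I_k -> 'I_n}) f t) / n%:R ^+ k.
Proof.
rewrite -(pair_big predT predT (fun p t => factor_prob (p, t) * f t)) /=.
rewrite exchange_big mulr_suml; apply: eq_bigr => t _ /=.
by rewrite -mulr_suml /factor_prob /= -mulr_suml rho_sum mul1r mulrC.
Qed.

Lemma factor_prob_ge0 v : 0 <= factor_prob v.
Proof. by rewrite divr_ge0 ?exprn_ge0. Qed.

(** For n = 0 and k > 0 there is no tuple and the total is 0. The upper bound covers every n, as the
    series must converge for n = 0 too. *)
Lemma factor_prob_total : 0 <= \sum_(v : factor) factor_prob v <= 1.
Proof.
have := sum_factor_prob (fun=> 1).
under eq_bigr do rewrite mulr1.
move=> ->; rewrite sumr_const card_ffun !card_ord natrX.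
have [->|n0] := eqVneq (n%:R ^+ k : R) 0; first by rewrite mul0r lexx ler01.
by rewrite divff // lexx ler01.
Qed.

Lemma factor_prob_sum1 : (0 < n)%N -> \sum_(v : factor) factor_prob v = 1.
Proof.
move=> n0; have := sum_factor_prob (fun=> 1).
under eq_bigr do rewrite mulr1.
move=> ->; rewrite sumr_const card_ffun !card_ord natrX divff //.
by rewrite expf_neq0 // pnatr_eq0 -lt0n.
Qed.

Lemma mean_cst m : mean (fun _ : Defs.fgraph Omega k n m => 1) =
  (\sum_(v : factor) factor_prob v) ^+ m.
Proof.
rewrite /mean; under eq_bigr do rewrite mulr1.
by rewrite -(bigA_distr_bigA (fun _ => factor_prob)) prodr_const card_ord.
Qed.

Lemma le_mean m (X Y : Defs.fgraph Omega k n m -> R) :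
  (forall om, X (graph_of psi om) <= Y (graph_of psi om)) -> mean X <= mean Y.
Proof.
move=> XY; apply: ler_sum => om _; apply: ler_wpM2l => //.
by apply: prodr_ge0 => b _; apply: factor_prob_ge0.
Qed.

Lemma mean_ge0 m (X : Defs.fgraph Omega k n m -> R) :
  (forall om, 0 <= X (graph_of psi om)) -> 0 <= mean X.
Proof.
move=> X0; apply: sumr_ge0 => om _; apply: mulr_ge0 => //.
by apply: prodr_ge0 => b _; apply: factor_prob_ge0.
Qed.

Lemma mean_affine m (X : Defs.fgraph Omega k n m -> R) c e :
  mean (fun G => c + e * X G) =
  c * (\sum_(v : factor) factor_prob v) ^+ m + e * mean X.
Proof.
rewrite -mean_cst /mean !mulr_sumr -big_split /=.
by apply: eq_bigr => om _; ring.
Qed.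

Lemma weight_delete m (om : {ffun 'I_m.+1 -> factor}) (a : 'I_m.+1) (s : config) :
  weight (graph_of psi om) (setT :\ a) s =
  weight (graph_of psi [ffun b => om (lift a b)]) setT s.
Proof.
rewrite !weightE (reindex_omap (lift a) (unlift a)) /=; last first.
  by move=> b; rewrite !inE => /andP[ba _]; case: unliftP ba => [j ->|->] //; rewrite eqxx.
apply: eq_big => [b|b _]; last by rewrite ffunE.
by rewrite !inE liftK eqxx eq_sym neq_lift.
Qed.

(** Links two encodings of G - a: a subset of m.+1 constraints, and a graph on m relabelled
    constraints. *)
Lemma rs_on_delete m (om : {ffun 'I_m.+1 -> factor}) (a : 'I_m.+1) :
  rs_on (graph_of psi om) (setT :\ a) =
  rs_stat (graph_of psi [ffun b => om (lift a b)]).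
Proof.
set om' := finfun _; rewrite rs_stat_on.
have wE s := weight_delete om a s.
have ZE : Zpart (graph_of psi om) (setT :\ a) = Zpart (graph_of psi om') setT.
  by rewrite !ZpartE; apply: eq_bigr => s _; apply: wE.
have mE x w : marg (graph_of psi om) (setT :\ a) x w = marg (graph_of psi om') setT x w.
  by rewrite !margE ZE; congr (_ / _); apply: eq_bigr => s _; apply: wE.
rewrite /rs_on; congr (_ / _); apply: eq_bigr => x _; apply: eq_bigr => y _.
rewrite !tvE; congr (_ * _); apply: eq_bigr => p _; rewrite !mE; congr (`|_ - _|).
by rewrite !marg2E ZE; congr (_ / _); apply: eq_bigr => s _; apply: wE.
Qed.

Variable K : R.
Hypotheses (K1 : 1 <= K) (hK : forall p tau, K^-1 <= psi p tau <= K).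
Hypotheses (Omega_gt0 : (0 < #|Omega|)%N) (n_gt0 : (0 < n)%N).

Definition defect (D : nat) : R :=
  (error_factor Omega K D * (2 ^+ D * #|Omega|%:R ^+ k * k%:R))%R.

(** There are (m.+1 * k) positions (a, i). Averaging over the tuple of a leaves a bound depending on
    G - a only, whose law is that of the random graph with m constraints. *)
Lemma mean_bp_err_le m (eta : R) (D : nat) : 0 < eta -> (0 < D)%N ->
  mean (@bp_err Omega k n m.+1) <=
  (m.+1 * k)%:R * (4 * (k * m)%:R / (n%:R * D%:R) + 2 * (k ^ 2)%:R / n%:R
    + defect D * (eta * (K ^+ D) ^+ 2) / 2 + defect D / eta * mean (@rs_stat Omega k n m)).
Proof.
move=> eta0 D0; set bnd := (X in _ * X).
have hKG M (om : {ffun 'I_M -> factor}) b tau : K^-1 <= fw (graph_of psi om) b tau <= K.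
  exact: hK.
apply: le_trans (_ : \sum_(a : 'I_m.+1) \sum_(i : 'I_k)
    mean (fun G => local_error G K D a i) <= _).
  rewrite /mean; under [leRHS]eq_bigr do rewrite exchange_big /=.
  rewrite [leRHS]exchange_big /=; apply: ler_sum => om _.
  under [leRHS]eq_bigr do rewrite -mulr_sumr.
  rewrite -mulr_sumr; apply: ler_wpM2l.
    by apply: prodr_ge0 => b _; apply: factor_prob_ge0.
  exact: (bp_err_le K1 (hKG _ om)).
rewrite natrM -mulrA !mulr_natl -[m.+1 in leRHS]card_ord -sumr_const.
apply: ler_sum => a _.
rewrite -[k in leRHS]card_ord -sumr_const; apply: ler_sum => i _.
have s1 := factor_prob_sum1 n_gt0.
(* Draw a fresh constraint at a: the inner sum becomes an average over its tuple, the others being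
   fixed. *)
rewrite /mean -[leLHS]mul1r -{1}s1 -(resample _ a).
pose c0 : R := (4 * (k * m)%:R / (n%:R * D%:R) + 2 * (k ^ 2)%:R / n%:R
    + defect D * (eta * (K ^+ D) ^+ 2) / 2)%R.
apply: le_trans (_ : \sum_(om : {ffun 'I_m.+1 -> factor})
   (\prod_b factor_prob (om b)) *
   (c0 + defect D / eta * rs_stat (graph_of psi [ffun b => om (lift a b)])) <= _).
  apply: ler_sum => om _; apply: ler_wpM2l.
    by apply: prodr_ge0 => b _; apply: factor_prob_ge0.
  under eq_bigr => v _.
    rewrite (@local_error_agree _ _ _ _ (graph_of psi om) a); last first.
    - by move=> b ba; rewrite /= updE (negPf ba).
    - by move=> b ba; rewrite /= updE (negPf ba).
    rewrite /= upd_same.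
    over.
  rewrite (sum_factor_prob (error_at (graph_of psi om) a K D i)).
  rewrite ler_pdivrMr ?exprn_gt0 ?ltr0n // mulrC.
  apply: le_trans (sum_error_at_le a K1 (hKG _ om) Omega_gt0 n_gt0 eta0 i D0) _.
  rewrite ler_wpM2l ?exprn_ge0 // -rs_on_delete /c0 -[m.+1.-1]/m.
  rewrite -[leRHS]addrA lerD2l /beta /defect le_eqVlt; apply/orP; left; apply/eqP.
  by field; rewrite gt_eqF.
rewrite (sum_ffun_lift factor_prob a
  (fun om' : {ffun 'I_m -> factor} => c0 + defect D / eta * rs_stat (graph_of psi om'))).
rewrite s1 mul1r.
have := mean_affine (@rs_stat Omega k n m) c0 (defect D / eta)%R.
by rewrite s1 expr1n mulr1 /bnd => <-.
Qed.

Lemma mean_bp_err0 : mean (@bp_err Omega k n 0) = 0.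
Proof.
apply: big1 => om _; apply/eqP; rewrite mulf_eq0; apply/orP; right.
rewrite eq_le bp_err_ge0 andbT.
have hKG b tau : K^-1 <= fw (graph_of psi om) b tau <= K by exact: hK.
by apply: le_trans (bp_err_le K1 hKG Omega_gt0 0) _; rewrite big_ord0.
Qed.

Lemma defect_ge0 D : 0 <= defect D.
Proof.
rewrite /defect; apply: mulr_ge0; first exact: error_factor_ge0.
by rewrite !mulr_ge0 ?exprn_ge0.
Qed.
End RandomGraph.

(** * Limits, nonnegative series and the Poisson distribution *)

Lemma Un_cvP (u : nat -> R) (l : R) :
  Un_cv u l <->
  (forall e : R, 0 < e -> exists N, forall n, (N <= n)%N -> `|u n - l| < e).
Proof.
split=> [h e /RltP e0|h e e0].
  have [N hN] := h e e0; exists N => n /ssrnat.leP Nn.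
  by have /RltP := hN n Nn; rewrite RdistE.
have [N hN] := h e (introT RltP e0); exists N => n Nn.
by apply/RltP; rewrite RdistE; apply/hN/ssrnat.leP.
Qed.

Lemma Un_cv_cst (c : R) : Un_cv (fun=> c) c.
Proof. by move=> e e0; exists 0%nat => n _; rewrite /Rdist Rminus_diag Rabs_R0. Qed.

Lemma Un_cv_le (u v : nat -> R) (l l' : R) :
  Un_cv u l -> Un_cv v l' -> (forall n, u n <= v n) -> l <= l'.
Proof. by move=> ul vl uv; apply/RleP; apply: (Rle_cv_lim _ ul vl) => n; apply/RleP. Qed.

Lemma poissonE lam m : poisson lam m = exp (- lam) * lam ^+ m / m`!%:R.
Proof. by rewrite /poisson RdivE RmultE RpowE INRE factE. Qed.

Lemma poisson_ge0 lam m : 0 <= lam -> 0 <= poisson lam m.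
Proof.
move=> l0; rewrite poissonE divr_ge0 // mulr_ge0 ?exprn_ge0 //.
by apply/RleP/Rlt_le/exp_pos.
Qed.

Lemma poisson_succ lam m :
  poisson lam m.+1 * m.+1%:R = lam * poisson lam m.
Proof.
rewrite !poissonE factS natrM exprS; field.
by rewrite nat1r !pnatr_eq0 -lt0n fact_gt0.
Qed.

Lemma poisson_sum lam : infinite_sum (poisson lam) 1.
Proof.
have H := CV_mult _ _ _ _ (Un_cv_cst (exp (- lam))) (proj2_sig (exist_exp lam)).
have -> : IZR 1 = Rmult (exp (- lam)) (sval (exist_exp lam)).

  by rewrite -[sval _]/(exp lam) -exp_plus Rplus_opp_l exp_0.
move=> e e0; have [N hN] := H e e0; exists N => n Nn.
have := hN n Nn; congr (Rlt (Rdist _ _) e).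
rewrite !sum_f_R0E RmultE mulr_sumr; apply: eq_bigr => i _.
by rewrite poissonE !RmultE RinvE INRE RpowE factE; ring.
Qed.

Lemma nonneg_series (f : nat -> R) (b : R) :
  (forall m, 0 <= f m) -> (forall M, sum_f_R0 f M <= b) ->
  exists l, [/\ infinite_sum f l, 0 <= l & l <= b].
Proof.
move=> f0 fb.
have gr : Un_growing (sum_f_R0 f).
  move=> M; apply/RleP; rewrite !sum_f_R0E [leRHS]big_nat_recr //= lerDl; exact: f0.
have ub : has_ub (sum_f_R0 f).
  by exists b => _ [M ->]; apply/RleP/fb.
have [l hl] := growing_cv _ gr ub.
exists l; split=> //.
  apply: le_trans (f0 0%N) _; apply/RleP.
  exact: (sum_incr f 0 l hl (fun m => elimT RleP (f0 m))).
exact: Un_cv_le hl (Un_cv_cst b) fb.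
Qed.

Lemma partial_sum_le (f : nat -> R) (l : R) M :
  (forall m, 0 <= f m) -> infinite_sum f l -> \sum_(0 <= m < M) f m <= l.
Proof.
move=> f0 fl; apply: le_trans (_ : sum_f_R0 f M <= _).
  by rewrite sum_f_R0E [leRHS]big_nat_recr //= lerDl.
by apply/RleP/sum_incr => // m; apply/RleP.
Qed.

Lemma poisson_partial lam M : 0 <= lam -> \sum_(0 <= m < M) poisson lam m <= 1.
Proof.
move=> l0; apply: partial_sum_le; last exact: poisson_sum.
by move=> m; apply: poisson_ge0.
Qed.

Lemma poisson_mean_partial lam M : 0 <= lam ->
  \sum_(0 <= m < M) poisson lam m * m%:R <= lam.
Proof.
move=> l0; case: M => [|M]; first by rewrite big_geq.
rewrite big_nat_recl // mulr0 add0r.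
under eq_bigr do rewrite poisson_succ.
by rewrite -mulr_sumr ler_piMr // poisson_partial.
Qed.

(** * The expected error per variable tends to 0 *)

Section Series.
Variables (d : R) (Omega : finType) (k : nat) (P : finType)
  (psi : P -> {ffun 'I_k -> Omega} -> R) (rho : P -> R).
Hypotheses (d_gt0 : 0 < d) (k_gt0 : (0 < k)%N).
Hypotheses (rho_ge0 : forall p, 0 <= rho p) (rho_sum : \sum_p rho p = 1).
Hypothesis psi_gt0 : forall p tau, 0 < psi p tau.

Lemma lam_ge0 n : 0 <= d * INR n / INR k.
Proof. by rewrite !INRE divr_ge0 ?mulr_ge0 // ltW. Qed.

Lemma psi_bounds : exists K : R, 1 <= K /\ forall p tau, K^-1 <= psi p tau <= K.
Proof.
pose S : R := \sum_p \sum_tau (psi p tau + (psi p tau)^-1).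
have t0 p tau : 0 <= psi p tau + (psi p tau)^-1 by apply: addr_ge0; rewrite ?invr_ge0; apply: ltW.
have S0 : 0 <= S by do 2!(apply: sumr_ge0 => ? _).
exists (1 + S); split=> [|p tau]; first by rewrite lerDl.
have le : psi p tau + (psi p tau)^-1 <= S.
  rewrite /S (bigD1 p) //= (bigD1 tau) //= -addrA lerDl addr_ge0 //.
    by apply: sumr_ge0.
  by do 2!(apply: sumr_ge0 => ? _).
have V0 : 0 < (psi p tau)^-1 by rewrite invr_gt0.
have p0 := psi_gt0 p tau.
rewrite -[psi p tau in X in X && _]invrK lef_pV2 ?posrE //; last by lra.
by apply/andP; split; lra.
Qed.

Lemma Eterm_rs_ge0 n m : 0 <= Eterm (n := n) psi rho d (fun m G => rs_stat G) m.
Proof.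
rewrite EtermE mulr_ge0 ?poisson_ge0 ?lam_ge0 // mean_ge0 // => om.
exact: rs_stat_ge0.
Qed.

(** [mean_bp_err_le] summed over the Poisson law and divided by n: the index shift turns the factor
    m.+1 * k into d * n, and the Poisson mean d * n / k turns 4 * k * m / (n * D) into 4 * d / D. *)
Definition err_bound (K eta E : R) (D n : nat) : R :=
  (d * (4 * d / D%:R + 2 * (k ^ 2)%:R / n%:R
   + defect Omega k K D * (eta * (K ^+ D) ^+ 2) / 2 + defect Omega k K D / eta * E))%R.

Lemma bp_partial_le (K eta E : R) (D n M : nat) :
  1 <= K -> (forall p tau, K^-1 <= psi p tau <= K) -> (0 < #|Omega|)%N ->
  0 < eta -> (0 < D)%N -> (0 < n)%N ->
  infinite_sum (Eterm (n := n) psi rho d (fun m G => rs_stat G)) E ->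
  sum_f_R0 (Eterm (n := n) psi rho d (fun m G => bp_err G)) M
  <= n%:R * err_bound K eta E D n.
Proof.
move=> K1 hK O0 eta0 D0 n0 hE.
set l := d * INR n / INR k; have l0 : 0 <= l := lam_ge0 n.
have lE : l = d * n%:R / k%:R by rewrite /l !INRE.
(* A graph without constraints has no messages, so the sum starts at m.+1, where [poisson_succ]
   applies. *)
rewrite sum_f_R0E big_nat_recl // EtermE (mean_bp_err0 n rho K1 hK O0) mulr0 add0r.
pose c1 : R := (4 * k%:R / (n%:R * D%:R))%R.
pose c2 : R := (2 * (k ^ 2)%:R / n%:R + defect Omega k K D * (eta * (K ^+ D) ^+ 2) / 2)%R.
pose c3 : R := (defect Omega k K D / eta)%R.
have n0' : n%:R != 0 :> R by rewrite pnatr_eq0 -lt0n.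
have k0' : k%:R != 0 :> R by rewrite pnatr_eq0 -lt0n.
have D0' : D%:R != 0 :> R by rewrite pnatr_eq0 -lt0n.
have d0 := defect_ge0 Omega k K1 D.
apply: le_trans (_ : \sum_(0 <= m < M) (l * k%:R) *
   (c1 * (poisson l m * m%:R) + (c2 * poisson l m +
   c3 * Eterm (n := n) psi rho d (fun m G => rs_stat G) m)) <= _).
  apply: ler_sum => m _.
  have EE X : Eterm (n := n) psi rho d X m = poisson l m * mean psi rho (X m).
    exact: EtermE.
  rewrite EtermE EE -[poisson _ m.+1]/(poisson l m.+1).
  have := mean_bp_err_le rho_ge0 rho_sum K1 hK O0 n0 m eta0 D0.
  move/(ler_wpM2l (poisson_ge0 m.+1 l0))/le_trans; apply.
  have := poisson_succ l m.
  move: (poisson l m.+1) (poisson l m) (mean _ _ _) => p1 p r p1E.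
  rewrite [(m.+1 * k)%:R]natrM -!(mulrA m.+1%:R) [p1 * _]mulrA p1E.
  rewrite le_eqVlt; apply/orP; left; apply/eqP.
  rewrite /c1 /c2 /c3; field.
  by rewrite n0' D0' gt_eqF.
rewrite -mulr_sumr !big_split /= -!mulr_sumr.
have -> : n%:R * err_bound K eta E D n = l * k%:R * (c1 * l + (c2 * 1 + c3 * E)).
  rewrite lE /err_bound /c1 /c2 /c3; field.
  by rewrite n0' D0' k0' gt_eqF.
apply: ler_wpM2l; first by rewrite mulr_ge0.
apply: lerD; first by apply: ler_wpM2l; [rewrite divr_ge0 ?mulr_ge0|apply: poisson_mean_partial].
apply: lerD; apply: ler_wpM2l.
- apply: addr_ge0; first by rewrite divr_ge0 ?mulr_ge0.
  by rewrite divr_ge0 // mulr_ge0 // mulr_ge0 ?sqr_ge0 // ltW.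
- exact: poisson_partial.
- by rewrite divr_ge0 // ltW.
by apply: partial_sum_le => // j; apply: Eterm_rs_ge0.
Qed.

Lemma bp_err_empty n m (G : Defs.fgraph Omega k n m) :
  #|Omega| = 0%N \/ n = 0%N -> bp_err G = 0.
Proof.
move=> h; rewrite /bp_err rsum_enum big1 // => x _.
case: h => [O0|n0]; last by exfalso; move: (nat_of_ord x) (ltn_ord x) => y; rewrite n0.
rewrite rsum_enum big1 // => a _; rewrite rsum_enum big1 // => w _.
by move/card0_eq: O0 => /(_ w); rewrite inE.
Qed.

Variable E : nat -> R.
Hypothesis hE : forall n,
  infinite_sum (Eterm (n := n) psi rho d (fun m G => rs_stat G)) (E n).

Lemma Eterm_bp_ge0 n m : 0 <= Eterm (n := n) psi rho d (fun m G => bp_err G) m.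
Proof.
rewrite EtermE mulr_ge0 ?poisson_ge0 ?lam_ge0 // mean_ge0 // => om.
exact: bp_err_ge0.
Qed.

Lemma err_bound_ge0 K eta D n : 1 <= K -> 0 < eta -> 0 <= err_bound K eta (E n) D n.
Proof.
move=> K1 eta0; have d0 := defect_ge0 Omega k K1 D.
have E0 : 0 <= E n.
  apply: le_trans (partial_sum_le 0 (Eterm_rs_ge0 n) (hE n)).
  by rewrite big_geq.
rewrite /err_bound; apply: mulr_ge0; first exact: ltW.
apply: addr_ge0; last by apply: mulr_ge0 => //; apply: divr_ge0 => //; apply: ltW.
apply: addr_ge0; first apply: addr_ge0.
- by apply: divr_ge0 => //; apply: mulr_ge0 => //; apply: ltW.
- by apply: divr_ge0 => //; apply: mulr_ge0.
apply: divr_ge0 => //; apply: mulr_ge0 => //; apply: mulr_ge0; [exact: ltW|exact: sqr_ge0].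
Qed.

Lemma mean_bp_err_exists K : 1 <= K -> (forall p tau, K^-1 <= psi p tau <= K) ->
  forall n, exists S : R,
  [/\ infinite_sum (Eterm (n := n) psi rho d (fun m G => bp_err G)) S, 0 <= S &
   forall (eta : R) (D : nat), 0 < eta -> (0 < D)%N -> (0 < n)%N ->
     S <= n%:R * err_bound K eta (E n) D n].
Proof.
move=> K1 hK n.
have [/andP[O0 n0]|] := boolP ((0 < #|Omega|)%N && (0 < n)%N).
  have hb eta D M := @bp_partial_le K eta (E n) D n M K1 hK O0.
  (* Convergence needs just one choice, eta = D = 1; the limit S then obeys the bound for every eta
     and D. *)
  have [S [hS S0 _]] := nonneg_series (Eterm_bp_ge0 n) (fun M => hb 1 1%N M ltr01 isT n0 (hE n)).
  exists S; split=> // eta D eta0 D0 _.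
  by apply: Un_cv_le hS (Un_cv_cst _) _ => M; apply: hb.
rewrite negb_and -!eqn0Ngt => h.
have {}h : #|Omega| = 0%N \/ n = 0%N by case/orP: h => /eqP; [left|right].
exists 0; split=> // [|eta D eta0 D0 n0].
  have z m : Eterm (n := n) psi rho d (fun m G => bp_err G) m = 0.
    rewrite EtermE /mean big1 ?mulr0 // => om _.
    by rewrite bp_err_empty // mulr0.
  move=> e e0; exists 0%nat => j _.
  rewrite sum_f_R0E big1 => [|i _]; last exact: z.
  by rewrite /Rdist Rminus_diag Rabs_R0.
by rewrite mulr_ge0 // err_bound_ge0.
Qed.

(** Each of the four terms in [err_bound] gets e / (4 d): D settles the degree term, eta (given D)
    the quadratic term, and large n (given both) the repetition and replica symmetry terms. The
    denominators 1 + Q and 1 + q / eta are positive even if Q or q is 0. *)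
Lemma bp_err_density_cv0 : Un_cv E 0 ->
  exists S : nat -> R,
  [/\ forall n, infinite_sum (Eterm (n := n) psi rho d (fun m G => bp_err G)) (S n),
      forall n, 0 <= S n & Un_cv (fun n => S n / n%:R) 0].
Proof.
move=> /Un_cvP E0; have [K [K1 hK]] := psi_bounds.
have [S hS] := functional_choice _ (mean_bp_err_exists K1 hK).
exists S; split=> [n|n|]; try by case: (hS n).
apply/Un_cvP => e e0.
have e4 : 0 < e / 4 / d by rewrite !divr_gt0.
have [D [D0 hD]] : exists D : nat, (0 < D)%N /\ 4 * d / D%:R < e / 4 / d.
  pose D := (Num.truncn (4 * d / (e / 4 / d))).+1.
  exists D; split=> //; have D0 : 0 < D%:R :> R by rewrite ltr0n.
  rewrite ltr_pdivrMr // [ltRHS]mulrC -ltr_pdivrMr //.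
  have x0 : 0 <= 4 * d / (e / 4 / d).
    by apply: divr_ge0; [apply: mulr_ge0 => //|]; apply: ltW.
  by case/andP: (truncn_itv x0).
set q := defect Omega k K D; have q0 : 0 <= q by apply: defect_ge0.
set Q := q * (K ^+ D) ^+ 2 / 2.
have Q0 : 0 <= Q by rewrite /Q divr_ge0 // mulr_ge0 ?sqr_ge0.
pose eta : R := (e / 4 / d / (1 + Q))%R.
have Q1 : 0 < 1 + Q by lra.
have eta0 : 0 < eta by rewrite divr_gt0.
have hQ : q * (eta * (K ^+ D) ^+ 2) / 2 < e / 4 / d.
  have -> : q * (eta * (K ^+ D) ^+ 2) / 2 = eta * Q by rewrite /Q; ring.
  by rewrite /eta mulrAC ltr_pdivrMr // ltr_pM2l //; lra.
have qe0 : 0 <= q / eta by rewrite divr_ge0 // ltW.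
have [N1 hN1] := E0 (e / 4 / d / (1 + q / eta)) ltac:(by rewrite divr_gt0 //; lra).
pose N2 := (Num.truncn (2 * (k ^ 2)%:R / (e / 4 / d))).+1.
exists (maxn N1 N2) => n; rewrite geq_max => /andP[n1 n2].
have n0 : (0 < n)%N by apply: leq_trans n2.
have n0' : 0 < n%:R :> R by rewrite ltr0n.
have [_ S0 hb] := hS n.
rewrite subr0 ger0_norm ?divr_ge0 // ltr_pdivrMr // mulrC.
apply: le_lt_trans (hb eta D eta0 D0 n0) _; rewrite ltr_pM2l // /err_bound.
have h1 : 2 * (k ^ 2)%:R / n%:R < e / 4 / d.
  rewrite ltr_pdivrMr // [ltRHS]mulrC -ltr_pdivrMr //.
  apply: lt_le_trans (_ : N2%:R <= _); last by rewrite ler_nat.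
  have x0 : 0 <= 2 * (k ^ 2)%:R / (e / 4 / d).
    by apply: divr_ge0; [apply: mulr_ge0|apply: ltW].
  by case/andP: (truncn_itv x0).
have h2 : q / eta * E n <= e / 4 / d.
  have := hN1 n n1; rewrite subr0 => /(le_lt_trans (ler_norm _)) /ltW h.
  apply: le_trans (ler_wpM2l qe0 h) _.
  rewrite mulrCA ler_piMr ?(ltW e4) // ler_pdivrMr; lra.
rewrite -/q mulrC -ltr_pdivlMr //.
have -> : e / d = e / 4 / d + e / 4 / d + e / 4 / d + e / 4 / d by field; rewrite gt_eqF.
by apply: ltr_leD => //; apply: ltrD => //; apply: ltrD.
Qed.
End Series.

(** * From expected error to probability *)

Section Markov.
Variables (d : R) (Omega : finType) (k : nat) (P : finType)
  (psi : P -> {ffun 'I_k -> Omega} -> R) (rho : P -> R).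
Hypotheses (d_gt0 : 0 < d).
Hypotheses (rho_ge0 : forall p, 0 <= rho p) (rho_sum : \sum_p rho p = 1).

Lemma bp_ind_bounds n m (eps : R) (G : Defs.fgraph Omega k n m) :
  0 <= bp_ind eps G <= 1.
Proof. by rewrite /bp_ind; case: (Rlt_dec _ _) => h /=; rewrite lexx ler01. Qed.

(** Markov's inequality before taking expectations, in the affine form that [mean_affine]
    integrates. *)
Lemma bp_ind_markov n m (eps : R) (G : Defs.fgraph Omega k n m) :
  (0 < n)%N -> 0 < eps -> 1 + (- (eps * n%:R)^-1) * bp_err G <= bp_ind eps G.
Proof.
move=> n0 e0; have en : 0 < eps * n%:R by rewrite mulr_gt0 ?ltr0n.
rewrite /bp_ind; case: (Rlt_dec _ _) => h /=.
  rewrite -[leRHS]addr0 lerD2l mulNr oppr_le0 mulr_ge0 ?bp_err_ge0 //.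
  by rewrite invr_ge0 ltW.
have {}h : eps * n%:R <= bp_err G.
  by rewrite leNgt; apply/RltP; rewrite -INRE.
by rewrite mulNr subr_le0 mulrC ler_pdivlMr // mul1r.
Qed.

(** Domination by the Poisson weights gives convergence and q <= 1 for every n. The lower bound sums
    [bp_ind_markov] and uses that the factor probabilities have total 1, hence 0 < n. *)
Lemma bp_ind_series n (eps S : R) :
  infinite_sum (Eterm (n := n) psi rho d (fun m G => bp_err G)) S ->
  exists q : R,
  [/\ infinite_sum (Eterm (n := n) psi rho d (fun m G => bp_ind eps G)) q,
      q <= 1 & (0 < n)%N -> 0 < eps -> 1 - S / (eps * n%:R) <= q].
Proof.
move=> hS; pose l := (d * INR n / INR k)%R.
have l0 : 0 <= l by apply: lam_ge0.
have EE X m : Eterm (n := n) psi rho d X m = poisson l m * mean psi rho (X m).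
  exact: EtermE.
have p0 m : 0 <= poisson l m by apply: poisson_ge0.
have t0 m : 0 <= Eterm (n := n) psi rho d (fun m G => bp_ind eps G) m.
  rewrite EE mulr_ge0 // mean_ge0 // => om.
  by case/andP: (bp_ind_bounds eps (graph_of psi om)).
have t1 m : Eterm (n := n) psi rho d (fun m G => bp_ind eps G) m <= poisson l m.
  rewrite EE ler_piMr //.
  apply: le_trans (_ : mean (m := m) psi rho (fun _ : Defs.fgraph Omega k n m => 1) <= _).
    by apply: le_mean => // om; case/andP: (bp_ind_bounds eps (graph_of psi om)).
  rewrite mean_cst; have /andP[u0 u1] := factor_prob_total k n rho_sum.
  exact: exprn_ile1.
have tM M : sum_f_R0 (Eterm (n := n) psi rho d (fun m G => bp_ind eps G)) M <= 1.
  by rewrite sum_f_R0E; apply: le_trans (poisson_partial M.+1 l0); apply: ler_sum.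
have [q [hq q0 q1]] := nonneg_series t0 tM.
exists q; split=> // n0 e0.
have en : 0 < eps * n%:R by rewrite mulr_gt0 ?ltr0n.
pose c := - (eps * n%:R)^-1.
have cv := CV_plus _ _ _ _ (poisson_sum l) (CV_mult _ _ _ _ (Un_cv_cst c) hS).
have -> : 1 - S / (eps * n%:R) = Rplus 1 (Rmult c S).
  by rewrite RplusE RmultE /c mulNr mulrC.
apply: (Un_cv_le cv hq) => M.
rewrite RplusE RmultE !sum_f_R0E mulr_sumr -big_split /=.
apply: ler_sum => m _; rewrite !EE mulrCA -[X in X + _]mulr1 -mulrDr.
apply: ler_wpM2l => //.
have u1 : \sum_v factor_prob (k := k) (n := n) rho v = 1.
  exact: factor_prob_sum1.
apply: le_trans (_ : mean psi rho (fun G : Defs.fgraph Omega k n m => 1 + c * bp_err G) <= _).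
  by rewrite mean_affine // u1 expr1n mulr1.
by apply: le_mean => // om; apply: bp_ind_markov.
Qed.
End Markov.

Unset Implicit Arguments.
Local Open Scope R_scope.

Theorem theorem1 (d : R) (Omega : finType) (k : nat) (P : finType)
  (psi : P -> {ffun 'I_k -> Omega} -> R) (rho : P -> R) :
  0 < d -> (3 <= k)%nat -> (0 < #|P|)%nat ->
  (forall p tau, 0 < psi p tau) ->
  (forall p, 0 <= rho p) -> rsum (enum P) rho = 1 ->
  forall E : nat -> R,
    (forall n, infinite_sum
       (Eterm (n := n) psi rho d (fun m G => rs_stat G)) (E n)) ->
    Un_cv E 0 ->
  exists eps : nat -> R, Un_cv eps 0 /\
    exists p : nat -> R,
      (forall n, infinite_sum
         (Eterm (n := n) psi rho d (fun m G => bp_ind (eps n) G)) (p n)) /\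
      Un_cv p 1.
Proof.
move=> /RltP d0 k3 _ psi0 rho0 rho1 E hE E0.
have k0 : (0 < k)%N by apply: leq_trans k3.
have {}psi0 p tau : (0 < psi p tau)%R by apply/RltP.
have {}rho0 p : (0 <= rho p)%R by apply/RleP.
have {}rho1 : (\sum_p rho p = 1)%R by rewrite -rsum_enum; apply: rho1.
have [S [hS S0 cvS]] := bp_err_density_cv0 d0 k0 rho0 rho1 psi0 hE E0.
pose del n : R := (S n / n%:R)%R.
have del0 n : (0 <= del n)%R by apply: divr_ge0.
(* Markov bounds the failure probability by del / eps, at most the square root of del; the second
   summand keeps eps positive when del is 0. *)
pose eps n : R := (Num.sqrt (del n) + n.+1%:R^-1)%R.
have s0 n : (0 <= Num.sqrt (del n))%R by apply: sqrtr_ge0.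
have eps0 n : (0 < eps n)%R by rewrite ltr_wpDl // invr_gt0 ltr0n.
have sqrt_small (e : R) : (0 < e)%R ->
    exists N, forall n, (N <= n)%N -> (Num.sqrt (del n) < e)%R.
  move=> e0; have /Un_cvP/(_ _ (exprn_gt0 2 e0)) [N hN] := cvS.
  exists N => n /hN; rewrite subr0 ger0_norm ?del0 // => h.
  by rewrite -(gtr0_norm e0) -sqrtr_sqr ltr_sqrt // exprn_gt0.
exists eps; split.
  apply/Un_cvP => e e0; have e2 : (0 < e / 2)%R by rewrite divr_gt0.
  have [N1 hN1] := sqrt_small _ e2.
  exists (maxn N1 (Num.truncn (e / 2)^-1)%R) => n; rewrite geq_max => /andP[/hN1 h1 h2].
  rewrite subr0 gtr0_norm // [e]splitr ltrD // invf_plt ?posrE ?ltr0n //.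
  have x0 : (0 <= (e / 2)^-1)%R by rewrite invr_ge0 ltW.
  by have /andP[_ h] := truncn_itv x0; apply: lt_le_trans h _; rewrite ler_nat.
have [p hp] := functional_choice _ (fun n => bp_ind_series d0 rho0 rho1 (eps n) (hS n)).
exists p; split=> [n|]; first by case: (hp n).
apply/Un_cvP => e e0; have [N hN] := sqrt_small e e0.
exists (maxn N 1) => n; rewrite geq_max => /andP[/hN h n0].
have [_ p1 /(_ n0 (eps0 n)) p2] := hp n.
rewrite distrC ger0_norm ?subr_ge0 //; apply: le_lt_trans h.
rewrite lerBlDr addrC -lerBlDr; apply: le_trans p2; rewrite lerD2l lerN2.
rewrite invfM mulrCA -/(del n) mulrC ler_pdivrMr //.
rewrite -[leLHS]sqr_sqrtr // expr2 ler_wpM2l // /eps lerDl.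
by rewrite invr_ge0.
Qed.
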